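(* Let $(M,g,J)$ be a Kähler manifold of complex dimension $2$, and let $E \to M$ be a holomorphic Hermitian line bundle. Let $\nabla^A$ be any connection on $E$ compatible with the holomorphic and Hermitian structures, and let $F_A$ be its curvature $2$-form. Then for every $p \in M$ such that $F_A(p) \neq 0$ (as a $2$-form), the operator by which $F_A(p)$ acts through Clifford multiplication on the fibre at $p$ of the twisted spinor bundle $\mathbb{S}_{\mathbb{C}} \otimes E$, where $\mathbb{S}_{\mathbb{C}} = \wedge^{0,0}M \oplus \wedge^{0,1}M \oplus \wedge^{0,2}M$, is indefinite, i.e. this Hermitian operator has both a strictly positive and a strictly negative eigenvalue.
   Context: Spinors: $M$ carries its canonical $\mathrm{Spin}^{\mathbb{C}}$-structure, whose spinor bundle is $\mathbb{S}_{\mathbb{C}} = \wedge^{0,*}M = \bigoplus_{i=0}^{2} \wedge^{0,i}M$ with the induced Hermitian metric. Clifford action: let $\{\xi^1,\xi^2,\bar\xi^1,\bar\xi^2\}$ be a local adapted frame of $T^*M\otimes\mathbb{C}$, i.e. $\{\xi^1,\xi^2\}$ is a local unitary frame of the $(1,0)$-forms and $\bar\xi^i$ are the conjugate $(0,1)$-forms, so that the Kähler form is $\omega = i(\xi^1\wedge\bar\xi^1+\xi^2\wedge\bar\xi^2)$. The Clifford action on $\wedge^{0,*}M$ is the complex-linear extension of $$\xi^i\cdot = -\sqrt{2}\,\bar\xi^i\lrcorner, \qquad \bar\xi^i\cdot = \sqrt{2}\,\bar\xi^i\wedge,$$ where $\bar\xi^i\lrcorner$ is the interior product (the antiderivation of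 degree $-1$ of $\wedge^{0,*}M$ with $\bar\xi^i\lrcorner\bar\xi^j=\delta_{ij}$). On $\wedge^{0,*}M\otimes E$ the Clifford action is on the first factor. Action of $2$-forms: a $2$-form $\alpha\wedge\beta$ acts on spinors through the identification $\alpha\wedge\beta \simeq \frac12(\alpha\beta-\beta\alpha)$ in the Clifford algebra, extended linearly. Connection: compatibility with the holomorphic and Hermitian structures means that $\nabla^A$ is the Chern connection of $E$ for the Hermitian metric. Since $E$ is a line bundle, $F_A$ is an (imaginary-valued, type $(1,1)$) scalar $2$-form on $M$, and it acts on $\mathbb{S}_{\mathbb{C}}\otimes E$ by Clifford multiplication as a Hermitian operator. *)

(* Defs.v *)
From HB Require Import structures.
From mathcomp Require Import all_boot all_order all_algebra.
From mathcomp Require Import complex.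
From mathcomp Require Import all_classical all_reals all_analysis.

Set Implicit Arguments.
Unset Strict Implicit.
Unset Printing Implicit Defensive.
Import Order.TTheory GRing.Theory Num.Theory.
Import numFieldNormedType.Exports.
Local Open Scope classical_set_scope.
Local Open Scope complex_scope.
Local Open Scope ring_scope.

(* C^2 as a real normed space: (x, y) stands for the point x + i y. *)
Notation C2 R := 'rV[R]_(2 + 2).

Section Model.
Variable R : realType.
Local Notation V := (C2 R).

(* Multiplication by i. *)
Definition Jst (v : V) : V := row_mx (- rsubmx v) (lsubmx v).

(* C^infinity on the open set U: all iterated directional derivatives are
   differentiable at every point of U. *)
Definition smooth_on (W : normedModType R) (U : set V) (f : V -> W) : Prop :=
  forall (vs : seq V) (x : V), U x ->
    differentiable (foldr (fun (v : V) (k : V -> W) => fun y => 'D_v k y) f vs) x.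

Definition holomorphic_on (U : set V) (f : V -> V) : Prop :=
  smooth_on U f /\
  forall x, U x -> forall v, 'D_(Jst v) f x = Jst ('D_v f x).

End Model.

(* [chartV i] is the inverse of [chart i] on the image of [dom i]; both are
   total functions, with irrelevant values elsewhere.  [pref] selects a chart
   around each point: T_pM is the model space C^2, a tangent vector at p being
   identified with its coordinates in the chart [pref p].  As the coordinate
   changes are holomorphic, the complex structure J of M is [Jst] on each
   T_pM.  A vector field is then a function M -> C^2. *)
Record complexSurface (R : realType) (M : topologicalType) := ComplexSurface {
  chartI : Type;
  dom : chartI -> set M;
  chart : chartI -> M -> C2 R;
  chartV : chartI -> C2 R -> M;
  pref : M -> chartI;
  _ : hausdorff_space M;
  _ : @second_countable M;
  _ : forall p, dom (pref p) p;
  _ : forall i, open (dom i);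
  _ : forall i, open (chart i @` dom i);
  _ : forall i p, dom i p -> chartV i (chart i p) = p;
  _ : forall i p, dom i p -> chart i q @[q --> p] --> chart i p;
  _ : forall i p, dom i p -> chartV i x @[x --> chart i p] --> p;
  _ : forall i j, holomorphic_on (chart i @` (dom i `&` dom j))
                                 (chart j \o chartV i) }.

Section Calculus.
Variables (R : realType) (M : topologicalType) (S : complexSurface R M).
Local Notation V := (C2 R).

Definition coord (p : M) : V := chart (pref S p) p.

(* f is C^infinity on a neighbourhood of p *)
Definition smooth_at (W : normedModType R) (f : M -> W) (p : M) : Prop :=
  exists2 U : set V, open U /\ U (coord p) &
    smooth_on U (f \o chartV (pref S p)).

Definition mdiff (f : M -> R) (p : M) (v : V) : R :=
  'D_v (f \o chartV (pref S p)) (coord p).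

Definition csmooth_at (f : M -> R[i]) (p : M) : Prop :=
  smooth_at (fun q => complex.Re (f q)) p /\ smooth_at (fun q => complex.Im (f q)) p.

Definition cdiff (f : M -> R[i]) (p : M) (v : V) : R[i] :=
  mdiff (fun q => complex.Re (f q)) p v +i* mdiff (fun q => complex.Im (f q)) p v.

Definition dbar (f : M -> R[i]) (p : M) (v : V) : R[i] :=
  2^-1 * (cdiff f p v + 'i * cdiff f p (Jst v)).

Definition holomorphic_at (f : M -> R[i]) (p : M) : Prop :=
  csmooth_at f p /\ \forall q \near p, forall v, dbar f q v = 0.

(* The differential at q of the chart i, from T_qM to C^2. *)
Definition dchart (i : chartI S) (q : M) (v : V) : V :=
  'D_v (chart i \o chartV (pref S q)) (coord q).

(* The coordinate vector field of the chart i in the constant direction u. *)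
Definition coordField (i : chartI S) (u : V) (q : M) : V :=
  'D_u (chart (pref S q) \o chartV i) (chart i q).

(* The expression of the vector field X in the chart around p. *)
Definition localField (p : M) (X : M -> V) (x : V) : V :=
  let q := chartV (pref S p) x in dchart (pref S p) q (X q).

Definition vsmooth_at (X : M -> V) (p : M) : Prop :=
  exists2 U : set V, open U /\ U (coord p) & smooth_on U (localField p X).

Definition lieBracket (X Y : M -> V) (p : M) : V :=
  'D_(X p) (localField p Y) (coord p) - 'D_(Y p) (localField p X) (coord p).

End Calculus.

Section Kaehler.
Variables (R : realType) (M : topologicalType) (S : complexSurface R M).
Local Notation V := (C2 R).

(* The bilinear form on T_pM with Gram matrix G. *)
Definition bil (G : 'M[R]_(2 + 2)) (u v : V) : R := (u *m G *m v^T) 0 0.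

(* The last axiom is d omega = 0 for omega(u, v) = g(J u, v), evaluated at p on
   coordinate fields, which commute. *)
Record kaehlerMetric := KaehlerMetric {
  metric :> M -> 'M[R]_(2 + 2);
  _ : forall p, (metric p)^T = metric p;
  _ : forall p v, v != 0 -> 0 < bil (metric p) v v;
  _ : forall p u v, bil (metric p) (Jst u) (Jst v) = bil (metric p) u v;
  _ : forall p (X Y : M -> V), vsmooth_at S X p -> vsmooth_at S Y p ->
        smooth_at S (fun q => bil (metric q) (X q) (Y q)) p;
  _ : forall p (u v w : V),
        let X a := coordField (pref S p) a in
        let om a b q := bil (metric q) (Jst (X a q)) (X b q) in
        mdiff S (om v w) p u + mdiff S (om w u) p v + mdiff S (om u v) p w = 0 }.

End Kaehler.

Section LineBundle.
Variables (R : realType) (M : topologicalType) (S : complexSurface R M).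
Local Notation V := (C2 R).

(* Fibres together with a covering family of nowhere vanishing local frames
   whose transition functions are holomorphic. *)
Record holLineBundle := HolLineBundle {
  fibre :> M -> lmodType R[i];
  trivI : Type;
  trivDom : trivI -> set M;
  frame : trivI -> forall p : M, fibre p;
  _ : forall k, open (trivDom k);
  _ : forall p, exists k, trivDom k p;
  _ : forall k p, trivDom k p ->
        frame k p != 0 /\ forall s : fibre p, exists c : R[i], s = c *: frame k p;
  _ : forall k l p, trivDom k p -> trivDom l p ->
        exists2 f : M -> R[i], holomorphic_at S f p &
          \forall q \near p, frame l q = f q *: frame k q }.

Variable E : holLineBundle.

Definition ssmooth_at (s : forall p, E p) (p : M) : Prop :=
  exists (k : trivI E) (f : M -> R[i]),
    [/\ trivDom k p, csmooth_at S f p & \forall q \near p, s q = f q *: frame k q].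

Record hermitianMetric := HermitianMetric {
  herm :> forall p, E p -> E p -> R[i];
  _ : forall p (c : R[i]) (s s' t : E p),
        herm (c *: s + s') t = c * herm s t + herm s' t;
  _ : forall p (s t : E p), herm t s = conjc (herm s t);
  _ : forall p (s : E p), s != 0 -> 0 < herm s s;
  _ : forall p (s t : forall q, E q), ssmooth_at s p -> ssmooth_at t p ->
        csmooth_at S (fun q => herm (s q) (t q)) p }.

(* [conn s p v] is the covariant derivative at p of s in the direction v; it is
   meaningful when s is smooth near p, and depends on the germ of s only. *)
Record connection := Connection {
  conn :> (forall p, E p) -> forall p : M, V -> E p;
  _ : forall p (s t : forall q, E q), ssmooth_at s p ->
        (\forall q \near p, s q = t q) -> conn s p = conn t p;
  _ : forall p (s : forall q, E q), ssmooth_at s p ->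
        forall (a : R) (u v : V),
        conn s p (a *: u + v) = a%:C *: conn s p u + conn s p v;
  _ : forall p (s t : forall q, E q), ssmooth_at s p -> ssmooth_at t p ->
        forall v, conn (fun q => s q + t q) p v = conn s p v + conn t p v;
  _ : forall p (f : M -> R[i]) (s : forall q, E q),
        csmooth_at S f p -> ssmooth_at s p ->
        forall v, conn (fun q => f q *: s q) p v
                  = cdiff S f p v *: s p + f p *: conn s p v;
  _ : forall p (X : M -> V) (s : forall q, E q),
        vsmooth_at S X p -> ssmooth_at s p ->
        ssmooth_at (fun q => conn s q (X q)) p }.

Variable nabla : connection.

(* The (0,1)-part of nabla is the Cauchy-Riemann operator of E, which maps f e
   to (dbar f) e for each holomorphic frame e. *)
Definition compatible_holomorphic : Prop :=
  forall (k : trivI E) (p : M) (f : M -> R[i]),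
    trivDom k p -> csmooth_at S f p ->
    forall v, let D := nabla (fun q => f q *: frame k q) p in
      2^-1 *: (D v + 'i *: D (Jst v)) = dbar S f p v *: frame k p.

Definition compatible_hermitian (h : hermitianMetric) : Prop :=
  forall p (s t : forall q, E q), ssmooth_at s p -> ssmooth_at t p ->
    forall v, cdiff S (fun q => h q (s q) (t q)) p v
              = h p (nabla s p v) (t p) + h p (s p) (nabla t p v).

Definition covd (X : M -> V) (s : forall p, E p) : forall p, E p :=
  fun p => nabla s p (X p).

(* F is the curvature of nabla, under the identification End(E) = C. *)
Definition is_curvature (F : M -> V -> V -> R[i]) : Prop :=
  forall p (X Y : M -> V) (s : forall q, E q),
    vsmooth_at S X p -> vsmooth_at S Y p -> ssmooth_at s p ->
    F p (X p) (Y p) *: s p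
    = covd X (covd Y s) p - covd Y (covd X s) p - nabla s p (lieBracket S X Y p).

End LineBundle.

Section Clifford.
Variable R : realType.
Local Notation V := (C2 R).

(* Complex covectors a (elements of T*M (x) C at a point) are given by their
   components in the dual of the standard basis. *)
Definition covec (a : 'rV[R[i]]_(2 + 2)) (v : V) : R[i] :=
  \sum_j a 0 j * (v 0 j)%:C.

Definition covconj (a : 'rV[R[i]]_(2 + 2)) : 'rV[R[i]]_(2 + 2) :=
  map_mx (@conjc R) a.

(* The Hermitian product induced on complex covectors by the metric G. *)
Definition coherm (G : 'M[R]_(2 + 2)) (a b : 'rV[R[i]]_(2 + 2)) : R[i] :=
  \sum_j \sum_k (invmx G j k)%:C * a 0 j * conjc (b 0 k).

(* Unitary frames xi of the (1,0)-forms at a point. *)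
Definition adapted (G : 'M[R]_(2 + 2)) (xi : 'I_2 -> 'rV[R[i]]_(2 + 2)) : Prop :=
  (forall i v, covec (xi i) (Jst v) = 'i * covec (xi i) v) /\
  (forall i j, coherm G (xi i) (xi j) = (i == j)%:R).

Variable E : lmodType R[i].

(* The fibre of (L^{0,0} + L^{0,1} + L^{0,2}) (x) E: triples of an element of
   E, a conjugate-linear E-valued form and an alternating E-valued form that is
   conjugate-linear in each argument; [preSpinor] drops these conditions. *)
Definition preSpinor : lmodType R[i] := (E * (V -> E) * (V -> V -> E))%type.

Definition conjlinear (f : V -> E) : Prop :=
  (forall (a : R) u v, f (a *: u + v) = a%:C *: f u + f v) /\
  (forall v, f (Jst v) = (- 'i) *: f v).

Definition spinor (psi : preSpinor) : Prop :=
  [/\ conjlinear psi.1.2,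
      forall v, conjlinear (fun u => psi.2 u v),
      forall u, conjlinear (psi.2 u)
    & forall v, psi.2 v v = 0].

Definition wedge (b : 'rV[R[i]]_(2 + 2)) (psi : preSpinor) : preSpinor :=
  (0, fun v => covec b v *: psi.1.1,
   fun u v => covec b u *: psi.1.2 v - covec b v *: psi.1.2 u).

(* Insertion in the first argument of the complex vector that represents
   a |-> coherm G a b.  If b is a member of a unitary frame of the (0,1)-forms,
   then this is the antiderivation that maps b to 1 and the other member of
   the frame to 0. *)
Definition interior (G : 'M[R]_(2 + 2)) (b : 'rV[R[i]]_(2 + 2))
    (psi : preSpinor) : preSpinor :=
  let ins (f : V -> E) : E :=
    \sum_j (\sum_k (invmx G j k)%:C * conjc (b 0 k)) *: f (delta_mx 0 j) in
  (ins psi.1.2, fun v => ins (fun u => psi.2 u v), fun _ _ => 0).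

(* Complex-linear extension of  xi_i |-> - sqrt 2 (interior product by the
   conjugate of xi_i)  and  conjugate of xi_i |-> sqrt 2 (exterior product by
   it):  the coefficients of a covector in the frame formed by the xi_i and
   their conjugates are its Hermitian products with the members of the frame. *)
Definition cliff (G : 'M[R]_(2 + 2)) (xi : 'I_2 -> 'rV[R[i]]_(2 + 2))
    (a : 'rV[R[i]]_(2 + 2)) (psi : preSpinor) : preSpinor :=
  \sum_(i < 2)
    (coherm G a (xi i) *:
       (- (Num.sqrt 2)%:C *: interior G (covconj (xi i)) psi)
     + coherm G a (covconj (xi i)) *:
       ((Num.sqrt 2)%:C *: wedge (covconj (xi i)) psi)).

(* The 2-form F is the sum over j < k of F(e_j, e_k) e^j /\ e^k, where (e_j) is
   the standard basis and (e^j) its dual basis. *)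
Definition cliff2 (G : 'M[R]_(2 + 2)) (xi : 'I_2 -> 'rV[R[i]]_(2 + 2))
    (F : V -> V -> R[i]) (psi : preSpinor) : preSpinor :=
  let c (j : 'I_(2 + 2)) := cliff G xi (delta_mx 0 j) in
  \sum_(j < 2 + 2) \sum_(k < 2 + 2 | (j < k)%N)
    F (delta_mx 0 j) (delta_mx 0 k) *:
      (2^-1 *: (c j (c k psi) - c k (c j psi))).

Definition spinor_eigenvalue (T : preSpinor -> preSpinor) (l : R[i]) : Prop :=
  exists psi : preSpinor, [/\ spinor psi, psi != 0 & T psi = l *: psi].

End Clifford.

(* Main.v *)
Require Import Defs.
From HB Require Import structures.
From mathcomp Require Import all_boot all_order all_algebra.
From mathcomp Require Import complex.
From mathcomp Require Import all_classical all_reals all_analysis.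
From mathcomp Require Import ring.

Set Implicit Arguments.
Unset Strict Implicit.
Unset Printing Implicit Defensive.

Import Order.TTheory GRing.Theory Num.Theory.
Import numFieldNormedType.Exports.
Local Open Scope classical_set_scope.
Local Open Scope complex_scope.
Local Open Scope ring_scope.

(** The curvature of the Chern connection is imaginary and of type (1,1), so it
    is given by a Hermitian 2 x 2 matrix phi in the unitary frame xi, and acts on
    spinors as the sum of the phi_il (ext_l ins_i - ins_i ext_l), where ext_l and
    ins_i are the exterior and interior products by conj xi_l and conj xi_i.  This
    is - tr phi on (0,0)-forms, tr phi on (0,2)-forms, and traceless on
    (0,1)-forms.  If tr phi = 0, its eigenvalues on (0,1)-forms are
    2 sqrt (- det phi) and - 2 sqrt (- det phi), and det phi < 0 as phi is nonzero,
    Hermitian and traceless.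

    For a holomorphic frame e and coordinate fields X, Y, which commute,
      F(X,Y) h(e,e) = X h(nabla_Y e, e) - Y h(nabla_X e, e)
                      - h(nabla_Y e, nabla_X e) + h(nabla_X e, nabla_Y e).
    Its real part vanishes as 2 Re h(nabla_X e, e) = X h(e,e), and its (0,2)-part
    as nabla_{JX} e = i nabla_X e; hence so does its (2,0)-part. *)

(** * Symmetry of second derivatives *)

Lemma is_derive_line (R : realType) (V W : normedModType R) (f : V -> W)
    (x u : V) (t : R) :
  differentiable f (x + t *: u) ->
  is_derive t 1 (fun s : R => f (x + s *: u)) ('D_u f (x + t *: u)).
Proof.
move=> df; pose l (s : R) : V := x + s *: u.
have [d1 d2] : is_diff t l ( *:%R^~ u).
  have dl := @is_diffD R R^o V (cst x) ( *:%R^~ u) _ _ t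
    (is_diff_cst _ _) (is_diff_scalel _ _).
  rewrite (_ : l = cst x + ( *:%R^~ u)) //; case: dl => d1 d2.
  by apply: DiffDef => //; rewrite d2 add0r.
have dfl : differentiable (f \o l) t.
  exact: differentiable_comp.
apply: DeriveDef; first exact: diff_derivable.
rewrite (deriveE _ dfl) diff_comp //.
by rewrite /= d2 scale1r deriveE.
Qed.

Lemma mean_value_line (R : realType) (V : normedModType R) (f : V -> R^o)
    (x u : V) (s : R) : 0 < s ->
  (forall t, 0 <= t <= s -> differentiable f (x + t *: u)) ->
  exists2 c : R, 0 <= c <= s & f (x + s *: u) - f x = s * 'D_u f (x + c *: u).
Proof.
move=> s0 df.
have [||c cI] := @MVT R (fun t => f (x + t *: u))
  (fun t => 'D_u f (x + t *: u)) 0 s s0.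
- move=> t; rewrite in_itv /= => /andP[/ltW t0 /ltW ts].
  by apply: is_derive_line; apply: df; rewrite t0.
- apply: derivable_within_continuous => t; rewrite in_itv /= => tI.
  exact: (@ex_derive _ _ _ _ _ _ _ (is_derive_line (df _ tI))).
rewrite scale0r addr0 subr0 mulrC => ->; exists c => //.
by move: cI; rewrite in_itv /= => /andP[/ltW -> /ltW ->].
Qed.

(** The mean value theorem is applied twice: to [g x = f (x + s *: v) - f x] along [u], which gives
    [b], then to ['D_u f] along [v], which gives [c]. The second difference on the left is symmetric
    in [u] and [v], so exchanging them yields the other mixed derivative. *)
Lemma second_difference (R : realType) (V : normedModType R) (f : V -> R^o)
    (a u v : V) (s : R) : 0 < s ->
  (forall b c, 0 <= b <= s -> 0 <= c <= s -> 
     differentiable f (a + b *: u + c *: v) /\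
     differentiable ('D_u f) (a + b *: u + c *: v)) ->
  exists b c, [/\ 0 <= b <= s, 0 <= c <= s &
   f (a + s *: u + s *: v) - f (a + s *: u) - f (a + s *: v) + f a =
   s * (s * 'D_v ('D_u f) (a + b *: u + c *: v))].
Proof.
move=> s0 df.
have ss : 0 <= s <= s by rewrite lexx ltW.
have s00 : 0 <= (0:R) <= s by rewrite lexx ltW.
have df0 b : 0 <= b <= s -> differentiable f (a + b *: u).
  by move=> bI; have [+ _] := df b 0 bI s00; rewrite scale0r addr0.
pose g x := f (x + s *: v) - f x.
have dsh (w x : V) : differentiable (fun y : V => y + w) x /\
    'd (fun y : V => y + w) x = id :> (V -> V).
  have dl := @is_diffD R V V id (cst w) _ _ x (is_diff_id _) (is_diff_cst _ _).
  rewrite (_ : (fun y : V => y + w) = id + cst w) //; case: dl => d1 d2.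
  by split=> //; rewrite d2 addr0.
have dfs b : 0 <= b <= s -> differentiable (fun x => f (x + s *: v)) (a + b *: u).
  move=> bI; apply: (@differentiable_comp _ _ _ _ (fun y : V => y + s *: v) f).
    by have [] := dsh (s *: v) (a + b *: u).
  by have [] := df b s bI ss.
have [b bI Eb] := @mean_value_line R V g a u s s0
  (fun t tI => differentiableB (dfs t tI) (df0 t tI)).
have [c cI Ec] := @mean_value_line R V ('D_u f) (a + b *: u) v s s0
  (fun t tI => (df b t bI tI).2).
exists b, c; split=> //; rewrite -Ec.
rewrite [LHS](_ : _ = g (a + s *: u) - g a); last by rewrite /g; ring.
rewrite Eb; congr (_ * _).
rewrite deriveB; first last.
- exact: diff_derivable (df0 _ bI).
- exact: diff_derivable (dfs _ bI).
congr (_ - _).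
rewrite deriveE ?[RHS]deriveE; last 2 first.
- by have [] := df b s bI ss.
- exact: dfs.
rewrite (@diff_comp R V V R^o (fun y : V => y + s *: v) f (a + b *: u)).
- by rewrite /=; have [_ ->] := dsh (s *: v) (a + b *: u).
- by have [] := dsh (s *: v) (a + b *: u).
- by have [] := df b s bI ss.
Qed.

Lemma no_common_half_ball (R : realFieldType) (a b x : R) :
  `|a - x| < `|a - b| / 2 -> `|b - x| < `|a - b| / 2 -> False.
Proof.
move=> ax bx; suff : `|a - b| < `|a - b| by rewrite ltxx.
rewrite [ltRHS]splitr (le_lt_trans (ler_distD x a b)) // ltrD //.
by rewrite distrC.
Qed.

(** If the mixed derivatives [A] and [B] at [a] differed, then by continuity each would stay within
    [|A - B| / 2] of its value at [a] on a common ball. One and the same second difference is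
    [s ^ 2] times a value of each of them in that ball, so they share a value there, which is
    impossible. *)
Lemma derive_comm (R : realType) (V : normedModType R) (f : V -> R^o)
    (U : set V) (a u v : V) : open U -> U a ->
  (forall x, U x -> differentiable f x) ->
  (forall x, U x -> differentiable ('D_u f) x) ->
  (forall x, U x -> differentiable ('D_v f) x) ->
  {for a, continuous ('D_v ('D_u f))} -> {for a, continuous ('D_u ('D_v f))} ->
  'D_v ('D_u f) a = 'D_u ('D_v f) a.
Proof.
move=> oU Ua df dfu dfv cvu cuv; apply/eqP; apply: contraT => neq.
set A := 'D_v _ a in neq *; set B := 'D_u _ a in neq *.
have e0 : 0 < `|A - B| / 2 by rewrite divr_gt0 // normr_gt0 subr_eq0.
have Hu : nbhs a [set x | `|A - 'D_v ('D_u f) x| < `|A - B| / 2].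
  by move/cvgrPdist_lt : cvu; apply.
have Hv : nbhs a [set x | `|B - 'D_u ('D_v f) x| < `|A - B| / 2].
  by move/cvgrPdist_lt : cuv; apply.
have HU : nbhs a U by exact: open_nbhs_nbhs.
have [r /= r0 rP] := (@nbhs_ballP R V a _).1 (filterI HU (filterI Hu Hv)).
(* With this step [s * (|u| + |v| + 1) = r / 2], so the whole parallelogram lies in the ball; the
   summand 1 keeps the denominator positive when [u = v = 0]. *)
pose s := r / (`|u| + `|v| + 1) / 2.
have d0 : 0 < `|u| + `|v| + 1 by rewrite ltr_wpDl // addr_ge0.
have s0 : 0 < s by rewrite !divr_gt0.
have bP b c : 0 <= b <= s -> 0 <= c <= s -> ball a r (a + b *: u + c *: v).
  move=> /andP[b0 bs] /andP[c0 cs]; rewrite -ball_normE /=.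
  rewrite -addrA opprD addrA subrr add0r normrN (le_lt_trans (ler_normD _ _)) //.
  rewrite !normrZ !ger0_norm //.
  apply: (@le_lt_trans _ _ (s * (`|u| + `|v| + 1))); last first.
    rewrite /s mulrAC divfK ?gt_eqF // ltr_pdivrMr // ltr_pMr // ltr1n //.
  rewrite !mulrDr mulr1 -[leLHS]addr0 lerD ?lerD ?ler_wpM2r // ltW //.
have [b [c [bI cI E]]] := @second_difference R V f a u v s s0
  (fun b c bI cI => let h := (rP _ (bP b c bI cI)).1 in conj (df _ h) (dfu _ h)).
have bP' b' c' : 0 <= b' <= s -> 0 <= c' <= s -> ball a r (a + b' *: v + c' *: u).
  by move=> ? ?; rewrite addrAC; apply: bP.
have [b' [c' [bI' cI' E']]] := @second_difference R V f a v u s s0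
  (fun b c bI cI => let h := (rP _ (bP' b c bI cI)).1 in conj (df _ h) (dfv _ h)).
have : 'D_v ('D_u f) (a + b *: u + c *: v) = 'D_u ('D_v f) (a + b' *: v + c' *: u).
  apply: (mulfI (lt0r_neq0 s0)); apply: (mulfI (lt0r_neq0 s0)).
  apply: etrans (esym E) (etrans _ E').
  rewrite (addrAC a (s *: v)); set X := f (_ + _ + _); ring.
have [_ [/= H1 _]] := rP _ (bP b c bI cI).
have [_ [_ /= H2]] := rP _ (bP' b' c' bI' cI').
move=> EE; rewrite -EE in H2.
by case: (no_common_half_ball H1 H2).
Qed.

(** Differentiability depends on the germ only: the first-order expansion of [f] at [x] is also one
    of [g], and uniqueness of the differential identifies its linear part with that of [g]. *)
Lemma near_eq_differentiable (R : realType) (V W : normedModType R)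
    (f g : V -> W) (x : V) :
  (\near x, f x = g x) -> differentiable f x -> differentiable g x.
Proof.
move=> fg df.
have fgx : f x = g x := nbhs_singleton fg.
have H : (g \o shift x = cst (g x) + 'd f x +o_ 0 id).
  have := diff_locally df => /eqaddoP fo.
  apply/eqaddoP => e e0; have {fo} := fo e e0.
  have : \forall h \near (0 : V), f (h + x) = g (h + x).
    have := fg; rewrite (near_shift 0 x).
    by apply: filterS => h /=; rewrite subr0.
  apply: filterS2 => h /= fgh.
  rewrite -![(_ + _ : _ -> _) _]/(_ + _) -![(- _ : _ -> _) _]/(- _).
  by rewrite /cst /= fgh fgx.
apply/diff_locallyP; have E := diff_unique (diff_continuous df) H.
split; first by rewrite E; exact: diff_continuous.
by rewrite E.
Qed.

(** * Coordinate fields *)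

Section SmoothOn.
Variables (R : realType) (W : normedModType R).
Local Notation V := (C2 R).

Lemma smooth_on_derivable_twice (U : set V) (f : V -> W) (x : V) :
  smooth_on U f -> U x ->
  [/\ differentiable f x, forall u, differentiable ('D_u f) x
    & forall u v, differentiable ('D_v ('D_u f)) x].
Proof.
move=> sf Ux; split=> [|u|u v]; first exact: (sf [::]).
- exact: (sf [:: u]).
- exact: (sf [:: v; u]).
Qed.

Lemma iterated_derive_near_cst (U : set V) (f : V -> W) (c : W) (vs : seq V) :
  open U -> (forall x, U x -> f x = c) ->
  exists c', forall x, U x ->
    foldr (fun (v : V) (k : V -> W) => fun y => 'D_v k y) f vs x = c'.
Proof.
move=> oU fc; elim: vs => [|v vs [c' IH]]; first by exists c.
exists 0 => x Ux /=; rewrite -(derive_cst c' x v).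
apply: near_eq_derive; have : nbhs x U by exact: open_nbhs_nbhs.
by apply: filterS => y /IH.
Qed.

(** The value of [f] is prescribed on [U] only. This is the situation of a coordinate field, whose
    local expression is constant on the image of the chart and arbitrary outside it. *)
Lemma smooth_on_cst (U : set V) (f : V -> W) (c : W) :
  open U -> (forall x, U x -> f x = c) -> smooth_on U f.
Proof.
move=> oU fc vs x Ux; have [c' cE] := iterated_derive_near_cst vs oU fc.
apply: (@near_eq_differentiable _ _ _ (cst c')); last exact: differentiable_cst.
have : nbhs x U by exact: open_nbhs_nbhs.
by apply: filterS => y /cE.
Qed.

End SmoothOn.

Lemma smooth_on_derive_comm (R : realType) (U : set (C2 R)) (f : C2 R -> R)
    (a u v : C2 R) : open U -> U a -> smooth_on U f ->
  'D_v ('D_u f) a = 'D_u ('D_v f) a.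
Proof.
move=> oU Ua sf; have s2 x := smooth_on_derivable_twice sf (x := x).
have [_ _ c] := s2 a Ua.
apply: (derive_comm oU Ua).
- by move=> x /s2[].
- by move=> x /s2[].
- by move=> x /s2[].
- exact: (differentiable_continuous (c u v)).
- exact: (differentiable_continuous (c v u)).
Qed.

Section Charts.
Variables (R : realType) (M : topologicalType) (S : complexSurface R M).
Local Notation V := (C2 R).
Implicit Types (i j : chartI S) (p q : M) (u v : V).

Lemma dom_pref p : dom (pref S p) p. Proof. by case: S p. Qed.

Lemma open_dom i : open (dom i). Proof. by case: S i. Qed.

Lemma open_chart_dom i : open (chart i @` dom i). Proof. by case: S i. Qed.

Lemma chartK i p : dom i p -> chartV i (chart i p) = p.
Proof. by case: S i p. Qed.

Lemma chartV_cvg i p : dom i p -> chartV i x @[x --> chart i p] --> p.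
Proof. by case: S i p. Qed.

Lemma holomorphic_transition i j :
  holomorphic_on (chart i @` (dom i `&` dom j)) (chart j \o chartV i).
Proof. by case: S i j. Qed.

Lemma nbhs_dom i q : dom i q -> nbhs q (dom i).
Proof. by move=> iq; apply: open_nbhs_nbhs; split=> //; exact: open_dom. Qed.

Lemma nbhs_overlap i j q : dom i q -> dom j q ->
  nbhs (chart i q) (chart i @` (dom i `&` dom j)).
Proof.
move=> iq jq.
have h1 : nbhs (chart i q) (chart i @` dom i).
  apply: open_nbhs_nbhs; split; first exact: open_chart_dom.
  by exists q.
have h2 := chartV_cvg iq (nbhs_dom jq).
apply: filterS2 h1 h2 => x [q' iq' <-] /=; rewrite chartK // => jq'.
by exists q'.
Qed.

Lemma differentiable_transition i j q : dom i q -> dom j q ->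
  differentiable (chart j \o chartV i) (chart i q).
Proof.
move=> iq jq; have [s _] := holomorphic_transition i j.
by apply: (s [::]); exists q.
Qed.

Lemma derive_transition_J i j q u : dom i q -> dom j q ->
  'D_(Jst u) (chart j \o chartV i) (chart i q)
  = Jst ('D_u (chart j \o chartV i) (chart i q)).
Proof.
by move=> iq jq; have [_ ->] := holomorphic_transition i j; [|exists q].
Qed.

(** Chain rule: near [chart i q], [f \o chartV i] is [f \o chartV j] composed with the transition
    map. *)
Lemma derive_change_chart (W : normedModType R) (f : M -> W) i j q u :
  dom i q -> dom j q -> differentiable (f \o chartV j) (chart j q) ->
  'D_u (f \o chartV i) (chart i q)
  = 'D_('D_u (chart j \o chartV i) (chart i q)) (f \o chartV j) (chart j q).
Proof.
move=> iq jq df; pose phi := chart j \o chartV i.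
have phiq : phi (chart i q) = chart j q by rewrite /phi /= chartK.
have dphi : differentiable phi (chart i q) by exact: differentiable_transition.
have df' : differentiable (f \o chartV j) (phi (chart i q)) by rewrite phiq.
transitivity ('D_u ((f \o chartV j) \o phi) (chart i q)).
  apply: near_eq_derive; have := nbhs_overlap iq jq.
  by apply: filterS => x [q' [iq' jq'] <-] /=; rewrite !chartK.
rewrite (deriveE _ (differentiable_comp dphi df')) diff_comp //.
by rewrite phiq -/phi (deriveE _ dphi) (deriveE _ df).
Qed.

Lemma derive_chartK i q u : dom i q ->
  'D_u (chart i \o chartV i) (chart i q) = u.
Proof.
move=> iq; rewrite -[RHS](derive_id (chart i q) u).
apply: near_eq_derive; have := nbhs_overlap iq iq.
by apply: filterS => x [q' [iq' _] <-] /=; rewrite chartK.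
Qed.

(** The two derivatives compose to that of [chart i \o chartV i], which is the identity near
    [chart i q]. Hence coordinate fields have constant local expression, are smooth and commute. *)
Lemma dchart_coordField i u q : dom i q -> dchart i q (coordField i u q) = u.
Proof.
move=> iq; rewrite /dchart /coordField -derive_change_chart ?derive_chartK //.
- exact: dom_pref.
- exact/differentiable_transition/iq/dom_pref.
Qed.

Lemma coordField_self p u : coordField (pref S p) u p = u.
Proof. exact/derive_chartK/dom_pref. Qed.

Lemma coordField_linear i q (a : R) u v : dom i q ->
  coordField i (a *: u + v) q = a *: coordField i u q + coordField i v q.
Proof.
move=> iq; have d := differentiable_transition iq (dom_pref q).
by rewrite /coordField !deriveE // linearP.
Qed.

Lemma coordField_J i q u : dom i q ->
  coordField i (Jst u) q = Jst (coordField i u q).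
Proof.
by move=> iq; rewrite /coordField derive_transition_J //; exact: dom_pref.
Qed.

Lemma localField_coordField p u x : (chart (pref S p) @` dom (pref S p)) x ->
  localField S p (coordField (pref S p) u) x = u.
Proof. by move=> [q iq <-]; rewrite /localField chartK // dchart_coordField. Qed.

Lemma chart_dom_coord p : (chart (pref S p) @` dom (pref S p)) (Defs.coord S p).
Proof. by exists p => //; exact: dom_pref. Qed.

Lemma coordField_smooth p u : vsmooth_at S (coordField (pref S p) u) p.
Proof.
exists (chart (pref S p) @` dom (pref S p)).
  by split; [exact: open_chart_dom|exact: chart_dom_coord].
apply: (smooth_on_cst (c := u) (@open_chart_dom _)) => x.
exact: localField_coordField.
Qed.

Lemma near_coord_dom p : nbhs (Defs.coord S p) (chart (pref S p) @` dom (pref S p)).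
Proof.
by apply: open_nbhs_nbhs; split; [exact: open_chart_dom|exact: chart_dom_coord].
Qed.

Lemma derive_localField_coordField p u v :
  'D_v (localField S p (coordField (pref S p) u)) (Defs.coord S p) = 0.
Proof.
transitivity ('D_v (cst u : V -> V) (Defs.coord S p)); last exact: derive_cst.
apply: near_eq_derive.
by apply: filterS (near_coord_dom p) => x /localField_coordField.
Qed.

Lemma lieBracket_coordField p u v :
  lieBracket S (coordField (pref S p) u) (coordField (pref S p) v) p = 0.
Proof.
apply: etrans (subr0 (0 : V)); rewrite /lieBracket.
congr (_ - _).
  exact: derive_localField_coordField.
exact: derive_localField_coordField.
Qed.

Lemma mdiff_near p (f f' : M -> R) u :
  (\forall q \near p, f q = f' q) -> mdiff S f p u = mdiff S f' p u.
Proof.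
move=> ff'; apply: near_eq_derive.
exact: (chartV_cvg (dom_pref p) ff').
Qed.

Lemma smooth_at_differentiable (W : normedModType R) (f : M -> W) p :
  smooth_at S f p -> differentiable (f \o chartV (pref S p)) (Defs.coord S p).
Proof. by move=> [U [oU Up] s]; exact: (s [::]). Qed.

(** On the left the derivative is taken in the chart preferred at [q], which varies with [q]; on the
    right it is taken in the one chart preferred at [p], where it can be differentiated again. *)
Lemma mdiff_coordField p q (f : M -> R) u : dom (pref S p) q ->
  smooth_at S f q ->
  mdiff S f q (coordField (pref S p) u q)
  = 'D_u (f \o chartV (pref S p)) (chart (pref S p) q).
Proof.
move=> pq /smooth_at_differentiable df.
by rewrite /mdiff [RHS](derive_change_chart _ pq (dom_pref q)).
Qed.

(** Read in the chart around [p], both sides are mixed second derivatives of [f], to which the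
    symmetry of second derivatives applies. *)
Lemma mdiff_coordField_comm p (f a b : M -> R) u v :
  smooth_at S f p -> (\forall q \near p, smooth_at S f q) ->
  (\forall q \near p, a q = mdiff S f q (coordField (pref S p) u q)) ->
  (\forall q \near p, b q = mdiff S f q (coordField (pref S p) v q)) ->
  mdiff S a p v = mdiff S b p u.
Proof.
move=> [U [oU Up] sf] sfn aE bE.
have pp := nbhs_dom (dom_pref p).
have key c w : (\forall q \near p, c q = mdiff S f q (coordField (pref S p) w q)) ->
    forall z, mdiff S c p z = 'D_z ('D_w (f \o chartV (pref S p))) (Defs.coord S p).
  move=> cE z; apply: near_eq_derive.
  have H : \forall q \near p,
      c q = 'D_w (f \o chartV (pref S p)) (chart (pref S p) q).
    by apply: filterS3 cE sfn pp => q -> sq dq; exact: mdiff_coordField.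
  have H' : \forall x \near Defs.coord S p, c (chartV (pref S p) x)
      = 'D_w (f \o chartV (pref S p)) (chart (pref S p) (chartV (pref S p) x)).
    exact: (chartV_cvg (dom_pref p) H).
  have := near_coord_dom p; apply: filterS2 H' => x.
  by move=> cx [q dq qE]; rewrite /= cx -qE chartK.
apply: etrans (key _ _ aE v) (etrans _ (esym (key _ _ bE u))).
exact: (smooth_on_derive_comm _ _ oU Up sf).
Qed.

Lemma mdiff_linear p (f : M -> R) (a : R) u v : smooth_at S f p ->
  mdiff S f p (a *: u + v) = a * mdiff S f p u + mdiff S f p v.
Proof.
by move=> /smooth_at_differentiable df; rewrite /mdiff !deriveE // linearP.
Qed.

(** The shape [a * f + b * g + k] covers the real and the imaginary part of a complex combination
    [c * f + g] at once. *)
Lemma mdiff_comb p (f g k : M -> R) (a b : R) u :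
  smooth_at S f p -> smooth_at S g p -> smooth_at S k p ->
  mdiff S (fun q => a * f q + b * g q + k q) p u
  = a * mdiff S f p u + b * mdiff S g p u + mdiff S k p u.
Proof.
move=> /smooth_at_differentiable df /smooth_at_differentiable dg.
move=> /smooth_at_differentiable dk.
have df' := diff_derivable (v := u) df; have dg' := diff_derivable (v := u) dg.
have dk' := diff_derivable (v := u) dk.
have daf := derivableZ (k := a) df'; have dbg := derivableZ (k := b) dg'.
apply: etrans (deriveD (derivableD daf dbg) dk') _.
by rewrite (deriveD daf dbg) (deriveZ a df') (deriveZ b dg').
Qed.

Lemma cdiff_near p (f f' : M -> R[i]) u :
  (\forall q \near p, f q = f' q) -> cdiff S f p u = cdiff S f' p u.
Proof.
by move=> ff'; congr (_ +i* _); apply: mdiff_near; apply: filterS ff' => q ->.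
Qed.

Lemma cdiff_linear p (f : M -> R[i]) (a : R) u v : csmooth_at S f p ->
  cdiff S f p (a *: u + v) = a%:C * cdiff S f p u + cdiff S f p v.
Proof.
move=> [sr si]; rewrite /cdiff !mdiff_linear //.
by apply/eqP; rewrite eq_complex /= !mul0r subr0 addr0 !eqxx.
Qed.

Lemma cdiff_comb p (f g : M -> R[i]) (c : R[i]) u :
  csmooth_at S f p -> csmooth_at S g p ->
  cdiff S (fun q => c * f q + g q) p u = c * cdiff S f p u + cdiff S g p u.
Proof.
move=> [fr fi] [gr gi]; case: c => a b; rewrite /cdiff.
apply/eqP; rewrite eq_complex /=; apply/andP; split; apply/eqP.
  rewrite -mulNr -(mdiff_comb _ _ _ fr fi gr); congr (mdiff S _ p u).
  apply/funext => q; case: (f q) => x y; case: (g q) => z t /=.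
  by rewrite mulNr.
rewrite -(mdiff_comb _ _ _ fi fr gi); congr (mdiff S _ p u).
by apply/funext => q; case: (f q) => x y; case: (g q).
Qed.

Lemma csmooth_at_cst (c : R[i]) p : csmooth_at S (fun=> c) p.
Proof.
by split; exists setT; do ?[split=> //; exact: openT];
  exact: (smooth_on_cst openT (fun _ _ => erefl)).
Qed.

End Charts.

(** * The curvature of a Chern connection *)

Section LineBundles.
Variables (R : realType) (M : topologicalType) (S : complexSurface R M).
Variable E : holLineBundle S.
Local Notation V := (C2 R).
Implicit Types (p q : M) (u v : V) (k : trivI E).

Lemma open_trivDom k : open (trivDom k). Proof. by case: E k. Qed.

Lemma trivDom_cover p : exists k, trivDom (h := E) k p. Proof. by case: E p. Qed.

Lemma frame_neq0 k p : trivDom k p -> frame k p != 0.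
Proof. by case: E k p => fib K D f o c fr tr k p; rewrite /= => /fr[]. Qed.

Lemma nbhs_trivDom k p : trivDom k p -> nbhs p (trivDom k).
Proof. by move=> kp; apply: open_nbhs_nbhs; split=> //; exact: open_trivDom. Qed.

Lemma ssmooth_frame k p : trivDom k p -> ssmooth_at (frame k) p.
Proof.
move=> kp; exists k, (fun=> 1); split=> //; first exact: csmooth_at_cst.
by apply: nearW => q; rewrite scale1r.
Qed.

Section Herm.
Variable h : hermitianMetric E.

Lemma herm_linearl p (c : R[i]) (s s' t : E p) :
  h p (c *: s + s') t = c * h p s t + h p s' t.
Proof. by case: h p c s s' t. Qed.

Lemma herm_conj p (s t : E p) : h p t s = conjc (h p s t).
Proof. by case: h p s t. Qed.

Lemma herm_gt0 p (s : E p) : s != 0 -> 0 < h p s s.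
Proof. by case: h p s. Qed.

Lemma herm_smooth p (s t : forall q, E q) : ssmooth_at s p -> ssmooth_at t p ->
  csmooth_at S (fun q => h q (s q) (t q)) p.
Proof. by case: h p s t. Qed.

Lemma herm0l p (t : E p) : h p 0 t = 0.
Proof.
by have := herm_linearl (-1) t t t; rewrite scaleN1r addNr mulN1r addNr.
Qed.

Lemma hermZl p c (s t : E p) : h p (c *: s) t = c * h p s t.
Proof. by rewrite -[c *: s]addr0 herm_linearl herm0l addr0. Qed.

Lemma hermDl p (s s' t : E p) : h p (s + s') t = h p s t + h p s' t.
Proof. by rewrite -[s]scale1r herm_linearl mul1r scale1r. Qed.

Lemma hermBl p (s s' t : E p) : h p (s - s') t = h p s t - h p s' t.
Proof. by rewrite hermDl -scaleN1r hermZl mulN1r. Qed.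

Lemma hermZr p c (s t : E p) : h p s (c *: t) = conjc c * h p s t.
Proof. by rewrite [LHS]herm_conj hermZl rmorphM [in RHS]herm_conj. Qed.

Lemma hermDr p (s t t' : E p) : h p s (t + t') = h p s t + h p s t'.
Proof.
by rewrite [LHS]herm_conj hermDl rmorphD [in RHS]herm_conj [h p s t']herm_conj.
Qed.

End Herm.

Section Conn.
Variable nabla : connection E.

Lemma conn_near p (s t : forall q, E q) : ssmooth_at s p ->
  (\forall q \near p, s q = t q) -> nabla s p = nabla t p.
Proof. by case: nabla p s t. Qed.

Lemma conn_linear p (s : forall q, E q) : ssmooth_at s p ->
  forall (a : R) u v, nabla s p (a *: u + v) = a%:C *: nabla s p u + nabla s p v.
Proof. by case: nabla p s. Qed.

Lemma conn_smooth p (X : M -> V) (s : forall q, E q) :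
  vsmooth_at S X p -> ssmooth_at s p -> ssmooth_at (covd nabla X s) p.
Proof. by case: nabla p X s. Qed.

Lemma conn0 p (s : forall q, E q) : ssmooth_at s p -> nabla s p 0 = 0.
Proof.
move=> ss; have := conn_linear ss (-1) 0 0.
by rewrite scaler0 addr0 rmorphN rmorph1 scaleN1r addNr.
Qed.

(** Compatibility with the holomorphic structure is applied to the coefficient 1, which [dbar]
    kills: the covariant derivative of a holomorphic frame is of type (1,0). *)
Lemma conn_frame_J k p v : compatible_holomorphic nabla -> trivDom k p ->
  nabla (frame k) p (Jst v) = 'i *: nabla (frame k) p v.
Proof.
move=> hol kp; have := hol k p (fun=> 1) kp (csmooth_at_cst S 1 p) v.
rewrite /= -(@conn_near p (frame k)); first last.
- by apply: nearW => q; rewrite scale1r.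
- exact: ssmooth_frame.
have c0 w : cdiff S (fun=> 1) p w = 0.
  have m0 (c : R) : mdiff S (fun=> c) p w = 0 by exact: (derive_cst c).
  by rewrite /cdiff !m0.
rewrite /dbar !c0 mulr0 addr0 mulr0 scale0r => /eqP.
rewrite scaler_eq0 invr_eq0 pnatr_eq0 /= addr_eq0 => /eqP ->.
by rewrite scalerN scalerA -expr2 sqrCi scaleN1r opprK.
Qed.

End Conn.
End LineBundles.


(* The pointwise data behind the curvature of a Chern connection: with [e] a
   holomorphic frame, [A u v] is the derivative at [p] in direction [v] of
   [h (nabla_u e) e], [Q u v] is [h (nabla_u e) (nabla_v e)] and [H] is [h e e]. *)
Record chernForm (R : realType) (f A Q : C2 R -> C2 R -> R[i]) (H : R) : Prop := {
  chern_gt0 : 0 < H;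
  chernE : forall u v, f u v * H%:C = A v u - A u v - Q v u + Q u v;
  chern_Al : forall (a : R) u v w, A (a *: u + v) w = a%:C * A u w + A v w;
  chern_Ar : forall (a : R) u v w, A w (a *: u + v) = a%:C * A w u + A w v;
  chern_Ql : forall (a : R) u v w, Q (a *: u + v) w = a%:C * Q u w + Q v w;
  chern_Qr : forall (a : R) u v w, Q w (a *: u + v) = a%:C * Q w u + Q w v;
  chern_AJ : forall u v, A (Jst u) v = 'i%C * A u v;
  chern_QJ : forall u v, Q (Jst u) v = 'i%C * Q u v;
  chern_QJr : forall u v, Q u (Jst v) = - 'i%C * Q u v;
  chern_Qconj : forall u v, Q v u = conjc (Q u v);
  chern_ReA : forall u v, complex.Re (A u v) = complex.Re (A v u) }.

Section ChernForm.
Variables (R : realType) (f A Q : C2 R -> C2 R -> R[i]) (H : R).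
Hypothesis fAQ : chernForm f A Q H.

Let H_neq0 : H%:C != 0.
Proof. by rewrite eq_complex /= eqxx andbT gt_eqF ?(chern_gt0 fAQ). Qed.

Lemma chernForm_antisym u v : f v u = - f u v.
Proof. by apply: (mulIf H_neq0); rewrite mulNr !(chernE fAQ); ring. Qed.

Lemma chernForm_linear (a : R) u v w :
  f (a *: u + v) w = a%:C * f u w + f v w.
Proof.
apply: (mulIf H_neq0); rewrite mulrDl -mulrA !(chernE fAQ).
rewrite !(chern_Al fAQ) !(chern_Ar fAQ) !(chern_Ql fAQ) !(chern_Qr fAQ).
by move: a%:C => c; ring.
Qed.

(** The [A] terms cancel in the real part by [chern_ReA], and the two [Q] terms are conjugate with
    opposite signs. *)
Lemma Re_chernForm u v : complex.Re (f u v) = 0.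
Proof.
have : complex.Re (f u v * H%:C) = 0.
  rewrite (chernE fAQ) (chern_Qconj fAQ u v) !raddfD !raddfN /=.
  by rewrite (chern_ReA fAQ u v); case: (Q u v) => x y /=; ring.
case: (f u v) => x y /=; rewrite mulr0 subr0 => /eqP.
by rewrite mulf_eq0 (gt_eqF (chern_gt0 fAQ)) orbF => /eqP.
Qed.

Lemma conj_chernForm u v : conjc (f u v) = - f u v.
Proof.
have := Re_chernForm u v; case: (f u v) => x y /= ->.
by apply/eqP; rewrite eq_complex /= oppr0 !eqxx.
Qed.

(* The (0,2)-part vanishes since [A] and [Q] are of type (1,0) in their first
   argument, hence so does its conjugate, the (2,0)-part. *)
Lemma chernForm_J u v : f (Jst u) (Jst v) = f u v.
Proof.
(* This is the complex-bilinear extension of [f] evaluated on the (0,1)-vectors [u + i Jst u] and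
   [v + i Jst v]. *)
have z02 : f u v + 'i%C * f (Jst u) v + 'i%C * f u (Jst v) - f (Jst u) (Jst v) = 0.
  apply: (mulIf H_neq0); rewrite mul0r !mulrDl mulNr -!mulrA !(chernE fAQ).
  rewrite !(chern_AJ fAQ) !(chern_QJ fAQ) !(chern_QJr fAQ).
  have i2 : ('i%C : R[i]) ^+ 2 = -1 by exact: sqr_i.
  by move: 'i%C i2 => j j2; ring: j2.
have conj4 (x y z t : R[i]) : conjc (x + 'i%C * y + 'i%C * z - t)
    = conjc x - 'i%C * conjc y - 'i%C * conjc z - conjc t.
  case: x y z t => [a b] [c d] [a' b'] [c' d'].
  by apply/eqP; rewrite eq_complex /=; apply/andP; split; apply/eqP; ring.
have := congr1 (@conjc R) z02; rewrite conj4 conjc0 !conj_chernForm => z20.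
have two : (2 : R[i]) != 0 by rewrite pnatr_eq0.
move: z02 z20; set x := f u v; set y := f (Jst u) (Jst v).
move: (f (Jst u) v) (f u (Jst v)) 'i%C => z t j z02 z20.
(* Since [f] is imaginary, conjugating [z02] changes the relative sign of the mixed terms; in the
   difference of the two identities they cancel, leaving [2 * (x - y)]. *)
apply: (mulfI two); apply/esym/eqP; rewrite -subr_eq0; apply/eqP.
apply: etrans (_ : _ = (x + j * z + j * t - y) - (- x - j * - z - j * - t - - y)) _.
  by ring.
by rewrite z02 z20 subr0.
Qed.

End ChernForm.

Section Curvature.
Variables (R : realType) (M : topologicalType) (S : complexSurface R M).
Variables (E : holLineBundle S) (h : hermitianMetric E) (nabla : connection E).
Hypothesis nabla_hol : compatible_holomorphic nabla.
Hypothesis nabla_herm : compatible_hermitian nabla h.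
Variables (p : M) (k : trivI E).
Hypothesis kp : trivDom k p.
Local Notation V := (C2 R).
Implicit Types (u v w z : V).
Local Notation e := (frame k).
Local Notation X := (coordField (pref S p)).
Local Notation om u := (fun q => h q (covd nabla (X u) e q) (e q)).
Local Notation Q u v := (h p (nabla e p u) (nabla e p v)).

Let ssmooth_e : ssmooth_at e p. Proof. exact: ssmooth_frame. Qed.

Let ssmooth_cov u : ssmooth_at (covd nabla (X u) e) p.
Proof. by apply: conn_smooth => //; exact: coordField_smooth. Qed.

Let om_smooth u : csmooth_at S (om u) p.
Proof. exact: herm_smooth. Qed.

Let near_dom : \forall q \near p, dom (pref S p) q /\ trivDom k q.
Proof. by apply: filterI; [exact/nbhs_dom/dom_pref|exact: nbhs_trivDom]. Qed.

Lemma curvature_frame (F : M -> V -> V -> R[i]) u v : is_curvature nabla F ->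
  F p u v * h p (e p) (e p)
  = cdiff S (om v) p u - cdiff S (om u) p v - Q v u + Q u v.
Proof.
move=> F_curv.
have := F_curv p (X u) (X v) e (coordField_smooth S p u)
  (coordField_smooth S p v) ssmooth_e.
rewrite lieBracket_coordField conn0 // subr0 !coordField_self.
move=> /(congr1 (fun s => h p s (e p))).
rewrite hermZl hermBl => ->.
(* Metric compatibility trades the second covariant derivatives of the frame for derivatives of the
   functions [om], up to the terms [Q]. *)
have D w z : cdiff S (om w) p z
    = h p (covd nabla (X z) (covd nabla (X w) e) p) (e p) + Q w z.
  by rewrite (nabla_herm (ssmooth_cov w) ssmooth_e z) /covd !coordField_self.
by rewrite (D v u) (D u v) opprD addrA -addrA addrACA [_ + Q u v]addrC; ring.
Qed.

Let norm_smooth q : trivDom k q ->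
  smooth_at S (fun q => complex.Re (h q (e q) (e q))) q.
Proof.
by move=> kq; have [] := herm_smooth h (ssmooth_frame kq) (ssmooth_frame kq).
Qed.

(** By metric compatibility the derivative of the squared norm of the frame is twice
    [complex.Re (om u q)]; the factor is spelled out in the shape that [mdiff_comb] accepts. *)
Let near_norm_derive u : \forall q \near p,
  mdiff S (fun q => complex.Re (h q (e q) (e q))) q (X u q)
  = 1 * complex.Re (om u q) + 0 * complex.Re (om u q) + complex.Re (om u q).
Proof.
apply: filterS near_dom => q [dq kq]; have se := ssmooth_frame kq.
have /(congr1 (@complex.Re R)) := nabla_herm se se (X u q).
rewrite [RHS]raddfD [h q (e q) _]herm_conj -/(covd nabla (X u) e q) /= => ->.
by case: (h q _ _) => a b /=; ring.
Qed.

(** Twice each side is a mixed second derivative of the squared norm of the frame along commuting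
    coordinate fields. *)
Lemma Re_cdiff_sym u v :
  complex.Re (cdiff S (om u) p v) = complex.Re (cdiff S (om v) p u).
Proof.
pose D w q := mdiff S (fun q => complex.Re (h q (e q) (e q))) q (X w q).
have Dom w z : mdiff S (D w) p z = 2 * complex.Re (cdiff S (om w) p z).
  have [sm _] := om_smooth w.
  rewrite (mdiff_near _ _ (near_norm_derive w)) (mdiff_comb _ _ _ sm sm sm).
  by rewrite mul1r mul0r addr0 mulr2n mulrDl mul1r.
have two : (2 : R) != 0 by rewrite pnatr_eq0.
apply: (mulfI two); apply: etrans (esym (Dom u v)) (etrans _ (Dom v u)).
apply: (mdiff_coordField_comm (norm_smooth kp)); try exact: nearW.
by apply: filterS (nbhs_trivDom kp) => q /norm_smooth.
Qed.

Lemma chernForm_curvature (F : M -> V -> V -> R[i]) : is_curvature nabla F ->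
  chernForm (F p) (fun u v => cdiff S (om u) p v) (fun u v => Q u v)
    (complex.Re (h p (e p) (e p))).
Proof.
move=> F_curv; have Hgt0 := herm_gt0 h (frame_neq0 kp).
have iE : ('i : R[i]) = 'i%C by rewrite complexiE.
have iJ : conjc 'i%C = - 'i%C :> R[i].
  by apply/eqP; rewrite eq_complex /= oppr0 !eqxx.
split.
- by move: Hgt0; rewrite ltcE => /andP[].
- move=> u v; rewrite -(curvature_frame u v F_curv); congr (_ * _).
  by apply: RRe_real; exact: gtr0_real.
- move=> a u v w.
  apply: etrans (cdiff_comb a%:C w (om_smooth u) (om_smooth v)).
  apply: cdiff_near; apply: filterS near_dom => q [dq kq].
  rewrite /covd coordField_linear // conn_linear ?herm_linearl //.
  exact: ssmooth_frame.
- by move=> a u v w; apply: cdiff_linear.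
- by move=> a u v w; rewrite conn_linear // herm_linearl.
- by move=> a u v w; rewrite conn_linear // hermDr hermZr conjc_real.
(* A zero summand is added so that [cdiff_comb] yields plain multiplication by the imaginary
   unit. *)
- move=> u v; have c0 := csmooth_at_cst S (0 : R[i]) p.
  have c00 : cdiff S (fun=> 0 : R[i]) p v = 0.
    by rewrite /cdiff /mdiff /comp derive_cst.
  rewrite -[RHS]addr0 -c00 -(cdiff_comb 'i%C v (om_smooth u) c0).
  apply: cdiff_near; apply: filterS near_dom => q [dq kq].
  by rewrite addr0 /covd coordField_J // conn_frame_J // iE hermZl.
- by move=> u v; rewrite conn_frame_J // iE hermZl.
- by move=> u v; rewrite conn_frame_J // iE hermZr iJ.
- by move=> u v; rewrite herm_conj.
- exact: Re_cdiff_sym.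
Qed.

End Curvature.

(** * Imaginary (1,1)-forms in a unitary frame *)

Section HermitianLinearAlgebra.
Variable R : realType.
Local Notation V := (C2 R).
Local Notation C := R[i].
Local Notation cj := (map_mx (@conjc R)).
Local Notation mxC := (map_mx (real_complex R)).

Definition Jmx : 'M[R]_(2 + 2) := block_mx 0 1%:M (- 1%:M) 0.

Lemma JstE (v : V) : Jst v = v *m Jmx.
Proof.
rewrite -[v in RHS]hsubmxK mul_row_block !mulmx0 mulmxN !mulmx1 add0r addr0.
by [].
Qed.

Lemma trmx_Jmx : Jmx^T = - Jmx.
Proof.
by rewrite /Jmx tr_block_mx opp_block_mx !trmx0 !raddfN /= trmx1 !oppr0 opprK.
Qed.

Lemma Jmx_sqr : Jmx *m Jmx = - 1%:M.
Proof.
rewrite /Jmx mulmx_block !mulmx0 !mul0mx mulmxN mulmx1 mulNmx mulmx1 !addr0 !add0r.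
by rewrite [in RHS]scalar_mx_block opp_block_mx oppr0.
Qed.

Lemma mul_delta_mx_entry (T : pzRingType) m n (A : 'M[T]_(m, n)) j k :
  ((delta_mx 0 j : 'rV_m) *m A *m (delta_mx 0 k : 'rV_n)^T) 0 0 = A j k.
Proof. by rewrite -rowE trmx_delta -colE !mxE. Qed.

Section Metric.
Variable G : 'M[R]_(2 + 2).
Hypothesis G_sym : G^T = G.
Hypothesis G_pos : forall v : V, v != 0 -> 0 < bil G v v.
Hypothesis G_J : forall u v : V, bil G (Jst u) (Jst v) = bil G u v.

Lemma metric_unitmx : G \in unitmx.
Proof.
rewrite -row_free_unit -kermx_eq0; apply: contraT => /rowV0Pn[v /sub_kermxP vG v0].
by have := G_pos v0; rewrite /bil vG mul0mx mxE ltxx.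
Qed.

Lemma metric_Jmx : Jmx *m G *m Jmx^T = G.
Proof.
apply/matrixP => j k; have := G_J (delta_mx 0 j) (delta_mx 0 k).
rewrite /bil mul_delta_mx_entry !JstE trmx_mul !mulmxA.
by rewrite -2!(mulmxA (delta_mx 0 j)) mul_delta_mx_entry.
Qed.

(** The Gram matrix of the induced metric on covectors, read with complex entries. *)
Definition comet : 'M[C]_(2 + 2) := mxC (invmx G).

(** As [Jmx] is skew with square -1, invariance of [G] under it means that it commutes with [G],
    hence with the inverse of [G]. *)
Lemma comet_Jmx : comet *m mxC Jmx = mxC Jmx *m comet.
Proof.
rewrite -!map_mxM; congr mxC; have uG := metric_unitmx.
have JG : G *m Jmx = Jmx *m G.
  rewrite -{1}metric_Jmx trmx_Jmx mulmxN mulNmx -!mulmxA Jmx_sqr.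
  by rewrite !mulmxN mulmx1 opprK.
apply: (can_inj (mulKmx uG)); apply: (can_inj (mulmxK uG)).
by rewrite !mulmxA mulmxV // mul1mx JG -!mulmxA mulVmx // mulmx1.
Qed.

Lemma trmx_comet : comet^T = comet.
Proof. by rewrite /comet map_trmx trmx_inv G_sym. Qed.

Lemma cj_mxC m n (A : 'M[R]_(m, n)) : cj (mxC A) = mxC A.
Proof. by apply/matrixP => i j; rewrite !mxE conjc_real. Qed.

Lemma cjK m n (A : 'M[C]_(m, n)) : cj (cj A) = A.
Proof. by apply/matrixP => i j; rewrite !mxE conjcK. Qed.

Lemma cjM m n o (A : 'M[C]_(m, n)) (B : 'M[C]_(n, o)) :
  cj (A *m B) = cj A *m cj B.
Proof. exact: map_mxM. Qed.

Lemma covecE (a : 'rV[C]_(2 + 2)) (v : V) : covec a v = (a *m (mxC v)^T) 0 0.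
Proof. by rewrite mxE; apply: eq_bigr => j _; rewrite !mxE. Qed.

Lemma covec_delta (a : 'rV[C]_(2 + 2)) j : covec a (delta_mx 0 j) = a 0 j.
Proof. by rewrite covecE map_delta_mx trmx_delta -colE mxE. Qed.

Lemma cohermE (a b : 'rV[C]_(2 + 2)) :
  coherm G a b = (a *m comet *m (cj b)^T) 0 0.
Proof.
rewrite /coherm -mulmxA mxE; apply: eq_bigr => j _; rewrite mxE big_distrr.
by apply: eq_bigr => k _; rewrite !mxE /=; ring.
Qed.

Variable xi : 'I_2 -> 'rV[C]_(2 + 2).
Hypothesis xi_adapted : adapted G xi.

Definition frame_mx : 'M[C]_(2, 2 + 2) := \matrix_(i, j) xi i 0 j.
Local Notation Xi := frame_mx.

Lemma row_frame_mx i : row i Xi = xi i.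
Proof. by apply/rowP => j; rewrite !mxE. Qed.

(** Composing a covector with [Jst] multiplies its row by [Jmx^T = - Jmx], whence the minus sign. *)
Lemma frame_mx_Jmx : Xi *m mxC Jmx = - 'i *: Xi.
Proof.
have [hJ _] := xi_adapted; apply/matrixP => i j.
have := hJ i (delta_mx 0 j); rewrite !covec_delta covecE JstE map_mxM map_delta_mx.
rewrite trmx_mul map_trmx trmx_Jmx raddfN /= mulNmx mulmxN trmx_delta mulmxA -colE.
rewrite !mxE => /eqP; rewrite eqr_oppLR -mulNr => /eqP <-.
by apply: eq_bigr => l _; rewrite !mxE.
Qed.

Lemma frame_mx_unitary : Xi *m comet *m (cj Xi)^T = 1%:M.
Proof.
have [_ hO] := xi_adapted; apply/matrixP => i j; rewrite [RHS]mxE -hO cohermE.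
rewrite -!row_frame_mx -mul_delta_mx_entry !rowE map_mxM map_delta_mx trmx_mul.
by rewrite !mulmxA.
Qed.

Lemma conjcM (x y : C) : conjc (x * y) = conjc x * conjc y.
Proof. exact: rmorphM. Qed.

Lemma conj_imaginary : conjc 'i = - 'i :> C.
Proof. by rewrite -complexiE; apply/eqP; rewrite eq_complex /= oppr0 !eqxx. Qed.

(** The bilinear extension of the metric is invariant under [Jmx], which acts on both arguments by
    the scalar -i; the product is thus equal to its opposite. *)
Lemma frame_mx_isotropic : Xi *m comet *m Xi^T = 0.
Proof.
have JJ : mxC Jmx *m (mxC Jmx)^T = 1%:M.
  by rewrite map_trmx -map_mxM trmx_Jmx mulmxN Jmx_sqr opprK map_mx1.
have E : Xi *m comet *m Xi^T = - (Xi *m comet *m Xi^T).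
  transitivity ((Xi *m mxC Jmx) *m comet *m (Xi *m mxC Jmx)^T).
    rewrite trmx_mul -(mulmxA Xi (mxC Jmx)) -comet_Jmx !mulmxA.
    by rewrite -(mulmxA (Xi *m comet)) JJ mulmx1.
  rewrite frame_mx_Jmx linearZ /= -!scalemxAl -scalemxAr scalerA.
  by rewrite mulrNN -expr2 sqrCi scaleN1r.
have : 2 *: (Xi *m comet *m Xi^T) = 0 by rewrite scaler_nat mulr2n {1}E addNr.
by move/eqP; rewrite scaler_eq0 pnatr_eq0 /= => /eqP.
Qed.

(* The rows are the components of the (1,0)-vectors dual to the frame [xi]. *)
Definition Zmx : 'M[C]_(2, 2 + 2) := cj Xi *m comet.
Local Notation Z := Zmx.

Lemma conj_Zmx : cj Z = Xi *m comet.
Proof.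
rewrite /Zmx map_mxM /comet cj_mxC; congr (_ *m _).
exact: cjK.
Qed.

Lemma conj_Zmx_frame : cj Z *m (cj Xi)^T = 1%:M.
Proof. by rewrite conj_Zmx frame_mx_unitary. Qed.

Lemma conj_Zmx_Jmx : cj Z *m mxC Jmx = - 'i *: cj Z.
Proof.
by rewrite conj_Zmx -mulmxA comet_Jmx mulmxA frame_mx_Jmx scalemxAl.
Qed.

Lemma Zmx_Jmx : Z *m mxC Jmx = 'i *: Z.
Proof.
apply: (can_inj (@cjK _ _)); rewrite map_mxM cj_mxC conj_Zmx_Jmx.
by apply/matrixP => i j; rewrite !mxE conjcM conj_imaginary.
Qed.

Lemma coherm_delta (a : 'rV[C]_(2 + 2)) j :
  coherm G (delta_mx 0 j) a = (cj a *m comet) 0 j.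
Proof.
rewrite cohermE -[in RHS]trmx_comet -[cj a]trmxK -trmx_mul.
by rewrite -mulmxA -rowE !mxE; apply: eq_bigr => l _; rewrite !mxE.
Qed.

(** The coefficient of a basis covector along [xi i] is its value on the [i]-th dual vector. *)
Lemma coherm_delta_frame j i : coherm G (delta_mx 0 j) (xi i) = Z i j.
Proof.
rewrite coherm_delta /Zmx -row_frame_mx map_row -row_mul [LHS]mxE.
by [].
Qed.

Lemma coherm_delta_conj_frame j i :
  coherm G (delta_mx 0 j) (covconj (xi i)) = conjc (Z i j).
Proof.
rewrite coherm_delta /covconj cjK -row_frame_mx -row_mul -conj_Zmx.
by rewrite !mxE.
Qed.

(* The vectors dual to [xi] and their conjugates form a basis. *)
Lemma dual_frame_form_eq0 (N : 'M[C]_(2 + 2)) :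
  Z *m N *m Z^T = 0 -> Z *m N *m (cj Z)^T = 0 ->
  cj Z *m N *m Z^T = 0 -> cj Z *m N *m (cj Z)^T = 0 -> N = 0.
Proof.
(* [P] stacks the frame and its conjugate, [Q] the dual vectors and their conjugates. Duality makes
   [Q] invertible, and the four hypotheses are the blocks of [Q *m N *m Q^T]. *)
move=> N1 N2 N3 N4; pose Q := col_mx Z (cj Z); pose P := col_mx Xi (cj Xi).
have PQ : P *m Q^T = 1%:M.
  rewrite tr_col_mx mul_col_row.
  have trZ : Xi *m Z^T = 1%:M.
    by rewrite /Zmx trmx_mul trmx_comet mulmxA frame_mx_unitary.
  have trcZ : Xi *m (cj Z)^T = 0.
    by rewrite conj_Zmx trmx_mul trmx_comet mulmxA frame_mx_isotropic.
  have cj1 : cj Xi *m (cj Z)^T = 1%:M.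
    by rewrite map_trmx -map_mxM trZ map_mx1.
  have cj0 : cj Xi *m Z^T = 0.
    by rewrite -[Z]cjK map_trmx -map_mxM trcZ map_mx0.
  by rewrite trZ trcZ cj0 cj1 -scalar_mx_block.
have uQ : Q^T \in unitmx by have [] := mulmx1_unit PQ.
have QNQ : Q *m N *m Q^T = 0.
  by rewrite tr_col_mx mul_col_mx mul_col_row N1 N2 N3 N4 /block_mx !row_mx0 col_mx0.
apply: (can_inj (mulmxK uQ)); rewrite unitmx_tr in uQ.
by apply: (can_inj (mulKmx uQ)); rewrite mulmxA QNQ mul0mx mulmx0.
Qed.

End Metric.
End HermitianLinearAlgebra.

Section Form11.
Variable R : realType.
Local Notation V := (C2 R).
Local Notation C := R[i].
Local Notation cj := (map_mx (@conjc R)).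
Local Notation mxC := (map_mx (real_complex R)).

(** Invariance under [Jst] expresses type (1,1); linearity in the second argument follows from
    antisymmetry. *)
Record imaginary11 (f : V -> V -> C) : Prop := {
  form_linear : forall (a : R) u v w, f (a *: u + v) w = a%:C * f u w + f v w;
  form_antisym : forall u v, f v u = - f u v;
  form_conj : forall u v, conjc (f u v) = - f u v;
  form_J : forall u v, f (Jst u) (Jst v) = f u v }.

Definition form_mx (f : V -> V -> C) : 'M[C]_(2 + 2) :=
  \matrix_(j, k) f (delta_mx 0 j) (delta_mx 0 k).

Variable f : V -> V -> C.
Hypothesis f11 : imaginary11 f.
Local Notation N := (form_mx f).

Lemma form_suml (I : Type) (r : seq I) (a : I -> R) (b : I -> V) w :
  f (\sum_(i <- r) a i *: b i) w = \sum_(i <- r) (a i)%:C * f (b i) w.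
Proof.
elim: r => [|i r IH]; last by rewrite !big_cons (form_linear f11) IH.
rewrite !big_nil; have := form_linear f11 (-1) 0 0 w.
by rewrite scaler0 addr0 rmorphN rmorph1 mulN1r addNr.
Qed.

Lemma formE u v : f u v = (mxC u *m N *m (mxC v)^T) 0 0.
Proof.
have expand (x y : V) : f x y = \sum_j (x 0 j)%:C * f (delta_mx 0 j) y.
  by rewrite {1}[x]row_sum_delta form_suml.
rewrite expand -mulmxA mxE; apply: eq_bigr => j _; rewrite mxE; congr (_ * _).
rewrite (form_antisym f11 v) expand mxE -sumrN; apply: eq_bigr => k _.
by rewrite !mxE (form_antisym f11 (delta_mx 0 j)) mulrN opprK mulrC.
Qed.

Lemma form_mx_tr : N^T = - N.
Proof. by apply/matrixP => j k; rewrite !mxE (form_antisym f11). Qed.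

Lemma form_mx_conj : cj N = - N.
Proof. by apply/matrixP => j k; rewrite !mxE (form_conj f11). Qed.

Lemma form_mx_J : mxC (Jmx R) *m N *m (mxC (Jmx R))^T = N.
Proof.
apply/matrixP => j k; rewrite [RHS]mxE -(form_J f11) formE !JstE.
rewrite !map_mxM !map_delta_mx trmx_mul -mul_delta_mx_entry.
by rewrite !mulmxA.
Qed.

Variables (G : 'M[R]_(2 + 2)) (xi : 'I_2 -> 'rV[C]_(2 + 2)).
Hypothesis G_sym : G^T = G.
Hypothesis G_pos : forall v : V, v != 0 -> 0 < bil G v v.
Hypothesis G_J : forall u v : V, bil G (Jst u) (Jst v) = bil G u v.
Hypothesis xi_adapted : adapted G xi.
Local Notation Z := (Zmx G xi).

(** Entry (i, l) is the complex-bilinear extension of [f] on the [i]-th dual vector and the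
    conjugate of the [l]-th one: the matrix phi of the overview. *)
Definition curv_mx : 'M[C]_2 := Z *m N *m (cj Z)^T.

(** [Jmx] acts on the rows of [Z] by i, so invariance of the form under it makes this block equal to
    its opposite. *)
Lemma form_mx_20 : Z *m N *m Z^T = 0.
Proof.
have E : Z *m N *m Z^T = - (Z *m N *m Z^T).
  rewrite -{1}form_mx_J.
  transitivity ((Z *m mxC (Jmx R)) *m N *m (Z *m mxC (Jmx R))^T).
    by rewrite (trmx_mul Z) !mulmxA.
  rewrite Zmx_Jmx // linearZ /= -!scalemxAl -scalemxAr scalerA.
  by rewrite -expr2 sqrCi scaleN1r.
have : 2 *: (Z *m N *m Z^T) = 0 by rewrite scaler_nat mulr2n {1}E addNr.
by move/eqP; rewrite scaler_eq0 pnatr_eq0 /= => /eqP.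
Qed.

Lemma form_mx_02 : cj Z *m N *m (cj Z)^T = 0.
Proof.
have := congr1 (fun A => - cj A) form_mx_20.
rewrite map_mx0 oppr0 => <-; rewrite (cjM (Z *m N)) (cjM Z) form_mx_conj -map_trmx.
by rewrite mulmxN mulNmx opprK.
Qed.

Lemma form_mx_opp_tr : cj Z *m N *m Z^T = - curv_mx^T.
Proof.
rewrite /curv_mx (trmx_mul (Z *m N)) (trmx_mul Z) trmxK form_mx_tr.
by rewrite mulNmx mulmxN opprK mulmxA.
Qed.

Lemma curv_mx_herm : cj curv_mx = curv_mx^T.
Proof.
rewrite -[RHS]opprK -form_mx_opp_tr /curv_mx (cjM (Z *m N)) (cjM Z) form_mx_conj.
by rewrite -map_trmx cjK mulmxN mulNmx.
Qed.

(** In the basis of dual vectors and their conjugates, the blocks of [f] are zero, phi, minus the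
    transpose of phi and zero; if phi vanished, so would [f]. *)
Lemma curv_mx_neq0 : (exists u v, f u v <> 0) -> curv_mx != 0.
Proof.
move=> [u [v uv0]]; apply/eqP => phi0; apply: uv0; rewrite formE.
suff -> : N = 0 by rewrite mulmx0 mul0mx mxE.
apply: (dual_frame_form_eq0 G_sym G_pos G_J xi_adapted form_mx_20 phi0 _ form_mx_02).
by rewrite form_mx_opp_tr phi0 trmx0 oppr0.
Qed.

End Form11.

(** * Clifford action of an imaginary (1,1)-form *)

Lemma sum_lt_antisym n (W : zmodType) (x : 'I_n -> 'I_n -> W) :
  (forall j, x j j = 0) ->
  \sum_(j < n) \sum_(k < n) x j k
  = \sum_(j < n) \sum_(k < n | (j < k)%N) (x j k + x k j).
Proof.
move=> x0; under [RHS]eq_bigr do rewrite big_split /=.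
rewrite big_split /= [X in _ + X](exchange_big_dep predT) //= -big_split /=.
apply: eq_bigr => j _; rewrite (bigID (fun k : 'I_n => (j < k)%N)) /=; congr (_ + _).
rewrite (bigD1 j) ?ltnn //= x0 add0r; apply: eq_bigl => k.
by rewrite -leqNgt [RHS]ltn_neqAle andbC.
Qed.

(** Antisymmetric coefficients absorb the commutators, so the sum over [j < k] that defines [cliff2]
    becomes half of a full double sum, in which the covectors can be expanded in another frame. *)
Lemma sum_lt_commutator (C : numFieldType) n (W : lmodType C)
    (a : 'I_n -> 'I_n -> C) (y : 'I_n -> 'I_n -> W) :
  (forall j k, a k j = - a j k) ->
  \sum_(j < n) \sum_(k < n | (j < k)%N) a j k *: (2^-1 *: (y j k - y k j))
  = 2^-1 *: \sum_(j < n) \sum_(k < n) a j k *: y j k.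
Proof.
move=> aN; rewrite sum_lt_antisym => [|j]; last first.
  move/eqP: (aN j j); rewrite -addr_eq0 -mulr2n mulrn_eq0 => /eqP ->.
  by rewrite scale0r.
rewrite scaler_sumr; apply: eq_bigr => j _; rewrite scaler_sumr.
apply: eq_bigr => k _; rewrite (aN j k) scaleNr -scalerBr !scalerA.
by rewrite mulrC.
Qed.

(** Used with [r] the square root of 2, for the two orders of a pair formed by an interior and an
    exterior product: the normalising factors of the Clifford action cancel the one half. *)
Lemma half_commutator (C : numFieldType) (W : lmodType C) (p r : C) (x y : W) :
  r * r = 2 ->
  2^-1 *: (p *: (- r *: (r *: x)) + - p *: (r *: (- r *: y))) = p *: (y - x).
Proof.
move=> r2; rewrite !scalerA !(mulrNN, mulrN, mulNr, opprK) -!mulrA r2.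
rewrite scalerDr !scalerA scalerBr addrC mulrN mulrCA mulVf ?pnatr_eq0 // mulr1.
by rewrite scaleNr.
Qed.

Lemma sum_form_expand (C : comNzRingType) n (I : finType) (W : lmodType C)
    (a : 'I_n -> 'I_n -> C) (c : I -> 'I_n -> C) (t : I -> I -> W) :
  \sum_j \sum_k a j k *: (\sum_x c x j *: (\sum_y c y k *: t x y))
  = \sum_x \sum_y (\sum_j \sum_k a j k * c x j * c y k) *: t x y.
Proof.
under [RHS]eq_bigr do under eq_bigr do
  [rewrite scaler_suml; under eq_bigr do rewrite scaler_suml].
under [RHS]eq_bigr do rewrite exchange_big /=.
rewrite [RHS]exchange_big; apply: eq_bigr => j _ /=.
under [RHS]eq_bigr do rewrite exchange_big /=.
rewrite [RHS]exchange_big; apply: eq_bigr => k _ /=.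
rewrite scaler_sumr; apply: eq_bigr => x _; rewrite scalerA scaler_sumr.
by apply: eq_bigr => y _; rewrite scalerA.
Qed.

(** The boolean separates the forms [xi] from their conjugates; pairs of equal type drop out, as
    they do for a form of type (1,1). *)
Lemma sum_pair_bool n (W : zmodType) (t : bool * 'I_n -> bool * 'I_n -> W) :
  (forall b i l, t (b, i) (b, l) = 0) ->
  \sum_x \sum_y t x y
  = \sum_(i < n) \sum_(l < n) (t (true, i) (false, l) + t (false, l) (true, i)).
Proof.
move=> t0.
have E x : \sum_y t x y = \sum_(l < n) t x (~~ x.1, l).
  rewrite (eq_bigr (fun y => (fun b l => t x (b, l)) y.1 y.2)); last by case.
  rewrite -(pair_bigA _ (fun b l => t x (b, l))) /= big_bool /=.
  case: x => -[] i /=; first by rewrite big1 ?add0r // => l _; rewrite t0.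
  by rewrite [X in _ + X]big1 ?addr0 // => l _; rewrite t0.
under eq_bigr do rewrite E.
pose s b i := \sum_(l < n) t (b, i) (~~ b, l).
rewrite (eq_bigr (fun x => s x.1 x.2)); last by case.
rewrite -(pair_bigA _ s) /= big_bool /s /=.
rewrite [X in _ + X]exchange_big -big_split; apply: eq_bigr => i _ /=.
by rewrite -big_split.
Qed.

Section CliffordAction.
Variables (R : realType) (E : lmodType R[i]).
Local Notation V := (C2 R).
Local Notation C := R[i].
Local Notation cj := (map_mx (@conjc R)).
Local Notation P := (preSpinor E).
Variables (G : 'M[R]_(2 + 2)) (xi : 'I_2 -> 'rV[C]_(2 + 2)).

Lemma preSpinorP (psi phi : P) : psi.1.1 = phi.1.1 ->
  psi.1.2 =1 phi.1.2 -> psi.2 =2 phi.2 -> psi = phi.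
Proof.
case: psi phi => [[s0 s1] s2] [[t0 t1] t2] /= -> /funext -> st; congr pair.
by apply/funext => u; apply/funext => v; exact: st.
Qed.

Lemma fct_linearE (T : Type) (W : lmodType C) (a : C) (f g : T -> W) x :
  (a *: f + g) x = a *: f x + g x.
Proof. by []. Qed.

Lemma wedge_linear b (a : C) (psi psi' : P) :
  wedge b (a *: psi + psi') = a *: wedge b psi + wedge b psi'.
Proof.
case: psi psi' => [[s0 s1] s2] [[t0 t1] t2].
apply: preSpinorP => [|v|u v] /=; do ?[rewrite !fct_linearE].
- by rewrite scaler0 addr0.
- by rewrite scalerDr !scalerA mulrC.
- by rewrite !scalerDr !scalerN !scalerA !(mulrC a) opprD addrACA.
Qed.

Lemma interior_linear b (a : C) (psi psi' : P) :
  Defs.interior G b (a *: psi + psi')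
  = a *: Defs.interior G b psi + Defs.interior G b psi'.
Proof.
case: psi psi' => [[s0 s1] s2] [[t0 t1] t2].
apply: preSpinorP => [|v|u v] /=; rewrite ?fct_linearE ?scaler0 ?addr0 //.
- rewrite scaler_sumr -big_split; apply: eq_bigr => j _ /=.
  by rewrite fct_linearE scalerDr !scalerA mulrC.
- rewrite scaler_sumr -big_split; apply: eq_bigr => j _ /=.
  by rewrite !fct_linearE scalerDr !scalerA mulrC.
Qed.

Local Notation Z := (Zmx G xi).

Definition ins_bar i (psi : P) : P := Defs.interior G (covconj (xi i)) psi.
Definition ext_bar i (psi : P) : P := wedge (covconj (xi i)) psi.

Lemma ins_barD i a psi psi' :
  ins_bar i (a *: psi + psi') = a *: ins_bar i psi + ins_bar i psi'.
Proof. exact: interior_linear. Qed.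

Lemma ext_barD i a psi psi' :
  ext_bar i (a *: psi + psi') = a *: ext_bar i psi + ext_bar i psi'.
Proof. exact: wedge_linear. Qed.

Local Notation rt2 := ((Num.sqrt 2)%:C : C).

(* [cop (b, i)] is the Clifford action of [xi i] if [b] holds and of its
   conjugate otherwise; [cco (b, i)] is the vector dual to that covector. *)
Definition cop (x : bool * 'I_2) (psi : P) : P :=
  if x.1 then - rt2 *: ins_bar x.2 psi else rt2 *: ext_bar x.2 psi.
Definition cco (x : bool * 'I_2) (j : 'I_(2 + 2)) : C :=
  if x.1 then Z x.2 j else conjc (Z x.2 j).

Lemma copD x a psi psi' : cop x (a *: psi + psi') = a *: cop x psi + cop x psi'.
Proof.
by rewrite /cop; case: x.1; rewrite ?ins_barD ?ext_barD scalerDr !scalerA (mulrC a).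
Qed.

Lemma cop_sum x (I : Type) (r : seq I) (c : I -> C) (psi : I -> P) :
  cop x (\sum_(i <- r) c i *: psi i) = \sum_(i <- r) c i *: cop x (psi i).
Proof.
elim: r => [|i r IH]; last by rewrite !big_cons copD IH.
by rewrite !big_nil; have := copD x (-1) 0 0; rewrite scaler0 addr0 scaleN1r addNr.
Qed.

Hypothesis G_sym : G^T = G.
Hypothesis G_pos : forall v : V, v != 0 -> 0 < bil G v v.
Hypothesis G_J : forall u v : V, bil G (Jst u) (Jst v) = bil G u v.
Hypothesis xi_adapted : adapted G xi.

Lemma cliff_delta j psi :
  cliff G xi (delta_mx 0 j) psi = \sum_x cco x j *: cop x psi.
Proof.
pose s b i := cco (b, i) j *: cop (b, i) psi.
rewrite (eq_bigr (fun x => s x.1 x.2)); last by case.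
rewrite -(pair_bigA _ s) /= exchange_big /s /=.
apply: eq_bigr => i _; rewrite big_bool.
by rewrite [coherm G _ (xi i)]coherm_delta_frame // coherm_delta_conj_frame.
Qed.

Variable f : V -> V -> C.
Hypothesis f11 : imaginary11 f.
Local Notation N := (form_mx f).
Local Notation phi := (curv_mx f G xi).

Let dual_mx (b : bool) := if b then Z else cj Z.

(** After the change of frame, the coefficient of a pair of Clifford operators is the form evaluated
    on the dual vectors. *)
Lemma cco_sum b b' i l :
  \sum_j \sum_k N j k * cco (b, i) j * cco (b', l) k
  = (dual_mx b *m N *m (dual_mx b')^T) i l.
Proof.
have dualE c m n : dual_mx c m n = cco (c, m) n by case: c; rewrite // mxE.
rewrite mxE exchange_big; apply: eq_bigr => k _.
rewrite [_^T k l]mxE dualE [(_ *m N) i k]mxE mulr_suml.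
by apply: eq_bigr => j _; rewrite dualE [N j k * _]mulrC.
Qed.

Lemma rt2_sqr : rt2 * rt2 = 2.
Proof. by rewrite -rmorphM -expr2 sqr_sqrtr ?ler0n // rmorph_nat. Qed.

Lemma ins_bar_scale i a psi : ins_bar i (a *: psi) = a *: ins_bar i psi.
Proof.
have i0 : ins_bar i 0 = 0.
  by have := ins_barD i (-1) 0 0; rewrite scaler0 addr0 scaleN1r addNr.
by have := ins_barD i a psi 0; rewrite i0 !addr0.
Qed.

Lemma ext_bar_scale i a psi : ext_bar i (a *: psi) = a *: ext_bar i psi.
Proof.
have i0 : ext_bar i 0 = 0.
  by have := ext_barD i (-1) 0 0; rewrite scaler0 addr0 scaleN1r addNr.
by have := ext_barD i a psi 0; rewrite i0 !addr0.
Qed.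

Lemma cliff2E psi : cliff2 G xi f psi
  = \sum_i \sum_l phi i l *: (ext_bar l (ins_bar i psi) - ins_bar i (ext_bar l psi)).
Proof.
pose c j : P -> P := cliff G xi (delta_mx 0 j).
have cE j k : c j (c k psi)
    = \sum_x cco x j *: (\sum_y cco y k *: cop x (cop y psi)).
  rewrite /c [LHS]cliff_delta; apply: eq_bigr => x _; congr (_ *: _).
  by rewrite cliff_delta cop_sum.
apply: etrans (sum_lt_commutator (fun j k => c j (c k psi))
  (fun j k => form_antisym f11 (delta_mx 0 j) (delta_mx 0 k))) _.
transitivity (2^-1 *: \sum_j \sum_k N j k *:
    (\sum_x cco x j *: (\sum_y cco y k *: cop x (cop y psi)))).
  congr (_ *: _); apply: eq_bigr => j _; apply: eq_bigr => k _.
  by rewrite cE mxE.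
rewrite sum_form_expand sum_pair_bool; last first.
  move=> b i l; rewrite cco_sum.
  by case: b; rewrite /= ?form_mx_20 ?form_mx_02 // mxE scale0r.
rewrite scaler_sumr; apply: eq_bigr => i _; rewrite scaler_sumr.
apply: eq_bigr => l _; rewrite !cco_sum.
(* By antisymmetry of [f], the pair taken in the opposite order carries the opposite coefficient. *)
have -> : (dual_mx false *m N *m (dual_mx true)^T) l i = - phi i l.
  by rewrite /dual_mx form_mx_opp_tr // mxE mxE.
rewrite /cop [(_, _).1]/= [(_, _).1]/= [(_, _).2]/= [(_, _).2]/=.
rewrite ins_bar_scale ext_bar_scale.
exact: (half_commutator _ _ _ rt2_sqr).
Qed.

End CliffordAction.

(** * Eigenvalues on spinors *)

Section Spectrum.
Variables (R : realType) (E : lmodType R[i]).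
Local Notation V := (C2 R).
Local Notation C := R[i].
Local Notation cj := (map_mx (@conjc R)).
Local Notation P := (preSpinor E).
Variables (G : 'M[R]_(2 + 2)) (xi : 'I_2 -> 'rV[C]_(2 + 2)).
Hypothesis G_sym : G^T = G.
Hypothesis G_pos : forall v : V, v != 0 -> 0 < bil G v v.
Hypothesis G_J : forall u v : V, bil G (Jst u) (Jst v) = bil G u v.
Hypothesis xi_adapted : adapted G xi.
Local Notation Z := (Zmx G xi).
Local Notation ins_bar := (ins_bar G xi).
Local Notation ext_bar := (ext_bar xi).
Variable e : E.
Hypothesis e_neq0 : e != 0.

Definition barxi l (v : V) : C := covec (covconj (xi l)) v.
(** [spinor0], [spinor1 l] and [spinor2 l m] are the tensor products with [e] of 1, of the conjugate
    of [xi l], and of the wedge product of the conjugates of [xi l] and [xi m]. *)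
Definition spinor0 : P := (e, fun=> 0, fun _ _ => 0).
Definition spinor1 l : P := (0, fun v => barxi l v *: e, fun _ _ => 0).
Definition spinor2 l m : P :=
  (0, fun=> 0, fun u v => (barxi l u * barxi m v - barxi l v * barxi m u) *: e).

Lemma barxi_linear l (a : R) u v :
  barxi l (a *: u + v) = a%:C * barxi l u + barxi l v.
Proof.
rewrite /barxi /covec mulr_sumr -big_split; apply: eq_bigr => j _ /=.
by rewrite !mxE rmorphD rmorphM /= mulrDr mulrCA.
Qed.

Lemma barxi_J l v : barxi l (Jst v) = - 'i * barxi l v.
Proof.
have conjE w : barxi l w = conjc (covec (xi l) w).
  rewrite /barxi /covec rmorph_sum; apply: eq_bigr => j _.
  by rewrite mxE -[X in _ * X]conjc_real -conjcM.
by have [hJ _] := xi_adapted; rewrite !conjE hJ conjcM conj_imaginary.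
Qed.

Lemma dual_barxi i l : \sum_j conjc (Z i j) * barxi l (delta_mx 0 j) = (i == l)%:R.
Proof.
transitivity ((cj Z *m (cj (frame_mx xi))^T) i l).
  by rewrite mxE; apply: eq_bigr => j _; rewrite /barxi covec_delta !mxE.
by rewrite conj_Zmx_frame // mxE.
Qed.

Lemma ins_barE i (psi : P) : ins_bar i psi =
  (\sum_j conjc (Z i j) *: psi.1.2 (delta_mx 0 j),
   fun v => \sum_j conjc (Z i j) *: psi.2 (delta_mx 0 j) v, fun _ _ => 0).
Proof.
have cE j : \sum_k (invmx G j k)%:C * conjc (covconj (xi i) 0 k) = conjc (Z i j).
  rewrite -coherm_delta_conj_frame // coherm_delta //.
  rewrite -[comet G]trmx_comet // mxE; apply: eq_bigr => k _.
  by rewrite !mxE mulrC.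
congr (_, _, _); first by apply: eq_bigr => j _; rewrite cE.
by apply/funext => v; apply: eq_bigr => j _; rewrite cE.
Qed.

Lemma ext_bar_spinor0 l : ext_bar l spinor0 = spinor1 l.
Proof. by apply: preSpinorP => [|v|u v] //=; rewrite !scaler0 subr0. Qed.

Lemma ext_bar_spinor1 l m : ext_bar l (spinor1 m) = spinor2 l m.
Proof.
apply: preSpinorP => [|v|u v] //=; first by rewrite scaler0.
by rewrite !scalerA scalerBl.
Qed.

Lemma ext_bar_spinor2 k l m : ext_bar k (spinor2 l m) = 0.
Proof. by apply: preSpinorP => [|v|u v] //=; rewrite !scaler0 ?subr0. Qed.

Lemma ins_bar_spinor0 i : ins_bar i spinor0 = 0.
Proof.
rewrite ins_barE; apply: preSpinorP => [|v|u v] //=.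
  by rewrite big1 // => j _; rewrite scaler0.
by rewrite big1 // => j _; rewrite scaler0.
Qed.

Lemma ins_bar_spinor1 i l : ins_bar i (spinor1 l) = (i == l)%:R *: spinor0.
Proof.
rewrite ins_barE; apply: preSpinorP => [|v|u v] /=.
- by rewrite -dual_barxi scaler_suml; apply: eq_bigr => j _; rewrite scalerA.
- by rewrite big1 => [|j _]; rewrite !scaler0.
- by rewrite [RHS]scaler0.
Qed.

Lemma ins_bar_spinor2 i l m :
  ins_bar i (spinor2 l m) = (i == l)%:R *: spinor1 m - (i == m)%:R *: spinor1 l.
Proof.
rewrite ins_barE -scaleNr addrC -[X in _ + X]/((i == l)%:R *: spinor1 m).
apply: preSpinorP => [|v|u v] /=.
- by rewrite big1 => [|j _]; rewrite ?scaler0 ?addr0.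
- rewrite -!dual_barxi.
  transitivity ((\sum_j conjc (Z i j) * barxi l (delta_mx 0 j)) *: (barxi m v *: e)
   - (\sum_j conjc (Z i j) * barxi m (delta_mx 0 j)) *: (barxi l v *: e)).
    rewrite scaler_suml [X in _ - X]scaler_suml -sumrB; apply: eq_bigr => j _.
    by rewrite !scalerA -scalerBl; congr (_ *: _); ring.
  by rewrite addrC -scaleNr.
- by rewrite -[RHS]/(_ *: 0 + _ *: 0) !scaler0 addr0.
Qed.

Lemma spinor0_spinor : spinor spinor0.
Proof.
have c0 : conjlinear (fun=> 0 : E) by split=> *; rewrite !scaler0 ?addr0.
by split.
Qed.

Lemma spinor1_spinor (x y : C) : spinor (x *: spinor1 0 + y *: spinor1 1).
Proof.
have c0 : conjlinear (fun=> x *: 0 + y *: 0 : E).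
  by split=> *; rewrite !scaler0 ?addr0 ?scaler0 ?addr0.
split=> //=; last by move=> v; rewrite -[LHS]/(x *: 0 + y *: 0) !scaler0 addr0.
split=> [a u v|v]; rewrite -![(_ + _ : _ -> _) _]/(x *: _ + y *: _) /=.
  rewrite !barxi_linear !scalerDl !scalerDr !scalerA.
  rewrite [in RHS]addrACA; congr (_ + _ + (_ + _)); congr (_ *: _); ring.
by rewrite !barxi_J scalerDr !scalerA; congr (_ *: _ + _ *: _); ring.
Qed.

Lemma spinor2_spinor l m : spinor (spinor2 l m).
Proof.
have c0 : conjlinear (fun=> 0 : E) by split=> *; rewrite !scaler0 ?addr0.
split=> //= [v|u|v]; last by rewrite mulrC subrr scale0r.
- split=> [a u w|u].
    by rewrite !barxi_linear scalerA -scalerDl; congr (_ *: _); ring.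
  by rewrite !barxi_J scalerA; congr (_ *: _); ring.
- split=> [a v w|v].
    by rewrite !barxi_linear scalerA -scalerDl; congr (_ *: _); ring.
  by rewrite !barxi_J scalerA; congr (_ *: _); ring.
Qed.

Lemma spinor0_neq0 : spinor0 != 0.
Proof. by apply: contra_neq e_neq0 => /(congr1 (fun psi : P => psi.1.1)). Qed.

Lemma ins_bar0 i : ins_bar i (0 : P) = 0.
Proof. by rewrite -(scale0r (0 : P)) ins_bar_scale !scale0r. Qed.

Lemma ext_bar0 l : ext_bar l (0 : P) = 0.
Proof. by rewrite -(scale0r (0 : P)) ext_bar_scale !scale0r. Qed.

(** The interior products by the two conjugate frame members extract the coefficients. *)
Lemma spinor1_comb_eq0 (x y : C) :
  x *: spinor1 0 + y *: spinor1 1 = 0 -> x = 0 /\ y = 0.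
Proof.
move=> E0.
have H (i : 'I_2) : (x * (i == 0)%:R + y * (i == 1)%:R) *: spinor0 = 0.
  rewrite -(ins_bar0 i) -E0 ins_barD ins_bar_scale.
  by rewrite (ins_bar_spinor1 i 0) (ins_bar_spinor1 i 1) !scalerA -scalerDl.
have z c : c *: spinor0 = 0 -> c = 0.
  by move/eqP; rewrite scaler_eq0 (negPf spinor0_neq0) orbF => /eqP.
by have /z := H 0; have /z := H 1; rewrite /= !mulr1 !mulr0 add0r addr0.
Qed.

Lemma spinor2_neq0 : spinor2 0 1 != 0.
Proof.
apply/eqP => E0; have := ins_bar_spinor2 0 0 1.
rewrite E0 ins_bar0 /= scale0r subr0 scale1r => s1.
have [] := @spinor1_comb_eq0 0 1; first by rewrite scale0r -s1 scaler0 addr0.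
by move=> _ /eqP; rewrite oner_eq0.
Qed.

Variable f : V -> V -> C.
Hypothesis f11 : imaginary11 f.
Local Notation phi := (curv_mx f G xi).
Local Notation T := (@cliff2 R E G xi f).

Lemma sum_I2 (W : nmodType) (x : 'I_2 -> W) : \sum_i x i = x 0 + x 1.
Proof. by rewrite big_ord_recl big_ord1; congr (_ + x _); exact: val_inj. Qed.

Lemma sum_delta_scale (W : lmodType C) m (x : 'I_2 -> W) :
  \sum_i (i == m)%:R *: x i = x m.
Proof.
rewrite (bigD1 m) //= eqxx scale1r big1 ?addr0 // => i /negPf ->.
by rewrite scale0r.
Qed.

(** Interior products kill degree 0, so only the terms [- ins_bar i (ext_bar l _)] remain, and these
    vanish unless [i = l]. *)
Lemma cliff2_spinor0 : T spinor0 = - \tr phi *: spinor0.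
Proof.
rewrite (cliff2E G_sym G_pos G_J xi_adapted f11) /mxtrace -sumrN scaler_suml.
apply: eq_bigr => i _.
rewrite -[RHS](sum_delta_scale i (fun l => - phi i l *: spinor0)).
apply: eq_bigr => l _; rewrite ins_bar_spinor0 ext_bar_spinor0 (ins_bar_spinor1 i l).
rewrite ext_bar0 sub0r [i == l]eq_sym.
by rewrite scalerN scaleNr scalerN !scalerA mulrC.
Qed.

(** The anticommutation of interior and exterior products turns [ext_l ins_i - ins_i ext_l] into
    [2 ext_l ins_i] minus the Kronecker delta of [i] and [l]; the delta terms sum to the trace. *)
Lemma cliff2_spinor1 m :
  T (spinor1 m) = 2 *: (\sum_l phi m l *: spinor1 l) - \tr phi *: spinor1 m.
Proof.
rewrite (cliff2E G_sym G_pos G_J xi_adapted f11).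
transitivity (\sum_i (i == m)%:R *: (2 *: \sum_l phi i l *: spinor1 l)
  - \sum_i \sum_l (l == i)%:R *: (phi i l *: spinor1 m)); last first.
  rewrite sum_delta_scale; congr (_ - _); rewrite /mxtrace scaler_suml.
  apply: eq_bigr => i _.
  exact: (sum_delta_scale i (fun l => phi i l *: spinor1 m)).
rewrite -sumrB; apply: eq_bigr => i _; rewrite !scaler_sumr -sumrB.
apply: eq_bigr => l _.
rewrite (ins_bar_spinor1 i m) ext_bar_scale ext_bar_spinor0 ext_bar_spinor1.
rewrite (ins_bar_spinor2 i l m).
rewrite opprB addrA -scalerDl scalerBr !scalerA [i == l]eq_sym.
by congr (_ *: _ - _ *: _); ring.
Qed.

Lemma cliff2_spinor2 : T (spinor2 0 1) = \tr phi *: spinor2 0 1.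
Proof.
have W0 l : spinor2 l l = 0.
  by apply: preSpinorP => [|v|u v] //=; rewrite mulrC subrr scale0r.
have W1 : spinor2 1 0 = - spinor2 0 1.
  apply: preSpinorP => [|v|u v] /=; rewrite ?oppr0 //.
  rewrite -[RHS]/(- (_ *: e)) -scaleNr opprB.
  by congr (_ *: _); ring.
rewrite (cliff2E G_sym G_pos G_J xi_adapted f11) /mxtrace sum_I2.
(* Exterior products kill degree 2, so only [ext_l ins_i] contributes; of its values, those with a
   repeated index vanish. *)
transitivity (\sum_i (i == 0)%:R *: (\sum_l phi i l *: spinor2 l 1)
  - \sum_i (i == 1)%:R *: (\sum_l phi i l *: spinor2 l 0)); last first.
  rewrite !sum_delta_scale !sum_I2 !W0 W1 !scaler0 addr0 add0r scalerN opprK.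
  by rewrite scalerDl.
rewrite -sumrB; apply: eq_bigr => i _; rewrite !scaler_sumr -sumrB.
apply: eq_bigr => l _.
rewrite ext_bar_spinor2 ins_bar0 subr0 (ins_bar_spinor2 i 0 1) addrC -scaleNr.
rewrite ext_barD ext_bar_scale !ext_bar_spinor1 scalerDr !scalerA mulrN scaleNr.
rewrite addrC.
by rewrite !(mulrC (phi i l)).
Qed.

Lemma cliff2_linear (a : C) (psi psi' : P) :
  T (a *: psi + psi') = a *: T psi + T psi'.
Proof.
rewrite !(cliff2E G_sym G_pos G_J xi_adapted f11).
rewrite scaler_sumr -big_split; apply: eq_bigr => i _ /=.
rewrite scaler_sumr -big_split; apply: eq_bigr => l _ /=.
rewrite !(ins_barD, ext_barD) scalerA (mulrC a) -scalerA -scalerDr; congr (_ *: _).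
by rewrite scalerBr opprD addrACA.
Qed.

Lemma linear_comb (W : lmodType C) (t : W -> W) :
  (forall a w w', t (a *: w + w') = a *: t w + t w') ->
  forall x y w w', t (x *: w + y *: w') = x *: t w + y *: t w'.
Proof.
move=> tl; have t0 : t 0 = 0.
  by have := tl (-1) 0 0; rewrite scaler0 addr0 scaleN1r addNr.
by move=> x y w w'; rewrite tl -[y *: w']addr0 tl t0 addr0.
Qed.

(** The hypotheses say that the row [(x, y)] is a left eigenvector of the matrix [p]; twice this
    matrix gives the action on (0,1)-spinors when the trace is zero. *)
Lemma eigenvector_comb (W : lmodType C) (d0 d1 : W) (x y mu p00 p01 p10 p11 : C) :
  x * p00 + y * p10 = mu * x -> x * p01 + y * p11 = mu * y ->
  x *: (2 *: (p00 *: d0 + p01 *: d1)) + y *: (2 *: (p10 *: d0 + p11 *: d1))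
  = (2 * mu) *: (x *: d0 + y *: d1).
Proof.
move=> Ex Ey; rewrite !scalerDr !scalerA addrACA -!scalerDl -!mulrA -Ex -Ey.
by congr (_ *: _ + _ *: _); ring.
Qed.

Lemma eigenvalue_spinor1 (mu : R) (x y : C) : \tr phi = 0 ->
  x != 0 \/ y != 0 ->
  x * phi 0 0 + y * phi 1 0 = mu%:C * x -> x * phi 0 1 + y * phi 1 1 = mu%:C * y ->
  spinor_eigenvalue T (2 * mu)%:C.
Proof.
move=> tr0 xy0 Ex Ey; exists (x *: spinor1 0 + y *: spinor1 1); split.
- exact: spinor1_spinor.
- by apply/eqP => /spinor1_comb_eq0[x0 y0]; case: xy0; rewrite ?x0 ?y0 eqxx.
have Ts m : T (spinor1 m) = 2 *: (phi m 0 *: spinor1 0 + phi m 1 *: spinor1 1).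
  by rewrite cliff2_spinor1 tr0 scale0r subr0 sum_I2.
apply: etrans (linear_comb cliff2_linear x y _ _) _.
rewrite (Ts 0) (Ts 1) rmorphM rmorph_nat.
exact: (eigenvector_comb _ _ Ex Ey).
Qed.

(** The matrix is the traceless Hermitian one with rows [(a, b)] and [(conjc b, - a)]; [mu ^+ 2] is
    the opposite of its determinant, so [mu] is a root of its characteristic polynomial. *)
Lemma hermitian_eigenvector (a mu : R) (b : C) :
  mu ^+ 2 = a ^+ 2 + complex.Re b ^+ 2 + complex.Im b ^+ 2 ->
  exists x y : C, [/\ x != 0 \/ y != 0, x * a%:C + y * conjc b = mu%:C * x
    & x * b + y * - a%:C = mu%:C * y].
Proof.
move=> mu2; have [b0|b0] := eqVneq b 0.
  move: mu2; rewrite b0 conjc0 /= expr0n /= !addr0 => /eqP; rewrite eqf_sqr.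
  case/orP => /eqP ->; [exists 1, 0|exists 0, 1]; split.
  - by left; rewrite oner_eq0.
  - by ring.
  - by ring.
  - by right; rewrite oner_eq0.
  - by ring.
  - by rewrite mul0r add0r mul1r mulr1 [RHS]rmorphN.
(* For nonzero [b] this row solves the second equation identically, and the first one by the value
   of [mu ^+ 2]. *)
exists ((mu + a)%:C), b; split; first by right.
  case: b mu2 {b0} => c d /= mu2.
  apply/eqP; rewrite eq_complex /=; apply/andP; split; apply/eqP; last by ring.
  have -> : (mu + a) * a - 0 * 0 + (c * c - d * - d)
    = a ^+ 2 + c ^+ 2 + d ^+ 2 + mu * a by ring.
  by rewrite -mu2; ring.
by rewrite rmorphD /=; ring.
Qed.

Theorem cliff2_indefinite : phi != 0 ->
  exists l m : R, [/\ 0 < l, m < 0, spinor_eigenvalue T l%:C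
    & spinor_eigenvalue T m%:C].
Proof.
move=> phi0.
have herm i j : conjc (phi i j) = phi j i.
  have := curv_mx_herm f11 G xi => /matrixP/(_ i j).
  by rewrite [LHS]mxE [RHS]mxE.
have diag i : phi i i = (complex.Re (phi i i))%:C.
  have := herm i i; case: (phi i i) => x y [] /eqP; rewrite eq_sym -addr_eq0.
  by rewrite -mulr2n mulrn_eq0 /= => /eqP ->.
pose t := complex.Re (phi 0 0) + complex.Re (phi 1 1).
have trE : \tr phi = t%:C.
  by rewrite /mxtrace sum_I2 [LHS](congr2 +%R (diag 0) (diag 1)) -rmorphD.
have e0 : spinor_eigenvalue T (- t)%:C.
  exists spinor0; split; [exact: spinor0_spinor|exact: spinor0_neq0|].
  by rewrite cliff2_spinor0 trE rmorphN.
have e2 : spinor_eigenvalue T t%:C.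
  exists (spinor2 0 1); split; [exact: spinor2_spinor|exact: spinor2_neq0|].
  by rewrite cliff2_spinor2 trE.
(* A nonzero trace already gives opposite eigenvalues in degrees 0 and 2; otherwise they are sought
   in degree 1. *)
have [t_lt0|t_gt0|t0] := ltgtP t 0.
- by exists (- t), t; split=> //; rewrite oppr_gt0.
- by exists t, (- t); split=> //; rewrite oppr_lt0.
pose a := complex.Re (phi 0 0); pose b := phi 0 1.
have phi11 : phi 1 1 = - a%:C.
  rewrite diag -rmorphN; congr (_%:C).
  by apply/eqP; rewrite -addr_eq0 addrC; apply/eqP.
have tr0 : \tr phi = 0 by rewrite trE t0.
(* This is the opposite of the determinant of the traceless matrix phi, and it vanishes only if phi
   does. *)
pose n2 := a ^+ 2 + complex.Re b ^+ 2 + complex.Im b ^+ 2.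
have eig mu : mu ^+ 2 = n2 -> spinor_eigenvalue T (2 * mu)%:C.
  move=> /hermitian_eigenvector[x [y [xy0 Ex Ey]]].
  apply: (eigenvalue_spinor1 tr0 xy0); first by rewrite diag -(herm 0 1).
  by rewrite phi11.
have n2_gt0 : 0 < n2.
  rewrite lt0r !addr_ge0 ?sqr_ge0 // andbT; apply: contra_neq phi0 => /eqP.
  rewrite !paddr_eq0 ?addr_ge0 ?sqr_ge0 // !sqrf_eq0 => /andP[/andP[/eqP a0 br] bi].
  have b0 : b = 0 by apply/eqP; rewrite eq_complex br bi.
  have c0 : phi 1 0 = 0 by rewrite -herm -/b b0 conjc0.
  have d0 : phi 0 0 = 0 by rewrite diag -/a a0.
  apply/matrixP => i j; rewrite [RHS]mxE.
  have I2 (k : 'I_2) : k = 0 \/ k = 1.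
    by case: k => -[|[|//]] k2; [left|right]; exact: val_inj.
  by case: (I2 i) (I2 j) => -> [] ->; rewrite ?d0 ?c0 ?phi11 ?a0 ?oppr0 -/b ?b0.
have s_gt0 : 0 < Num.sqrt n2 by rewrite sqrtr_gt0.
exists (2 * Num.sqrt n2), (2 * - Num.sqrt n2); split.
- by rewrite mulr_gt0.
- by rewrite mulrN oppr_lt0 mulr_gt0.
- by apply: eig; rewrite sqr_sqrtr // ltW.
- by apply: eig; rewrite sqrrN sqr_sqrtr // ltW.
Qed.

End Spectrum.

(** * Indefiniteness of the curvature operator *)

Section MetricAxioms.
Variables (R : realType) (M : topologicalType) (S : complexSurface R M).
Variables (g : kaehlerMetric S) (p : M).

Lemma metric_sym : (g p)^T = g p. Proof. by case: g p. Qed.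

Lemma metric_pos v : v != 0 -> 0 < bil (g p) v v.
Proof. by case: g p v. Qed.

Lemma metric_J u v : bil (g p) (Jst u) (Jst v) = bil (g p) u v.
Proof. by case: g p u v. Qed.

End MetricAxioms.

Theorem mainTheorem1 (R : realType) (M : topologicalType)
    (S : complexSurface R M) (g : kaehlerMetric S)
    (E : holLineBundle S) (h : hermitianMetric E)
    (nabla : connection E)
    (nabla_hol : compatible_holomorphic nabla)
    (nabla_herm : compatible_hermitian nabla h)
    (F : M -> C2 R -> C2 R -> R[i])
    (F_curv : is_curvature nabla F)
    (p : M) (F_neq0 : exists u v : C2 R, F p u v <> 0)
    (xi : 'I_2 -> 'rV[R[i]]_(2 + 2)) (xi_adapted : adapted (g p) xi) :
  exists l m : R,
    [/\ 0 < l, m < 0,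
        spinor_eigenvalue (@cliff2 R (E p) (g p) xi (F p)) l%:C
      & spinor_eigenvalue (@cliff2 R (E p) (g p) xi (F p)) m%:C].
Proof.
(* The local frame serves twice: it computes the curvature near [p], and its nonzero value at [p] is
   the vector of the fibre from which the eigenspinors are built. *)
have [k kp] := trivDom_cover E p.
have chern := chernForm_curvature nabla_hol nabla_herm kp F_curv.
have f11 : imaginary11 (F p).
  split; [exact: chernForm_linear chern|exact: chernForm_antisym chern
         |exact: conj_chernForm chern|exact: chernForm_J chern].
apply: (cliff2_indefinite (metric_sym g p) (@metric_pos _ _ _ g p)
  (@metric_J _ _ _ g p) xi_adapted (frame_neq0 kp) f11).
exact: (curv_mx_neq0 f11 (metric_sym g p) (@metric_pos _ _ _ g p)
  (@metric_J _ _ _ g p) xi_adapted F_neq0).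
Qed.
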